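(* Let $\mathbf{G}$ be one of the ind-groups $\mathbf{G}(E)$ or $\mathbf{G}^\omega(E)$, and let $\mathbf{P}$ and $\mathbf{B}$ be respectively a splitting parabolic subgroup and a splitting Borel subgroup of $\mathbf{G}$ containing $\mathbf{H}$. Then we have a decomposition $$\mathbf{G}=\bigsqcup_{w\in\mathbf{W}/\mathbf{W}_{\mathbf{P}}}\mathbf{B}\hat{w}\mathbf{P}.$$
   Context: $\mathbb{K}$ is an algebraically closed field of characteristic zero; $V$ is a $\mathbb{K}$-vector space of countably infinite dimension with basis $E$, and $E=\bigcup_{n\ge1}E_n$ is a filtration by finite subsets $E_n\subset E_{n+1}$. $\langle\cdot\rangle$ denotes linear span. $\mathbf{G}(E)$ is the group of linear automorphisms $g$ of $V$ with $g(e)=e$ for all but finitely many $e\in E$; it is the ind-group $\bigcup_nGL(\langle E_n\rangle)$ (acting trivially on $E\setminus E_n$). When $\mathbf{G}^\omega(E)$ is considered, $V$ carries a nondegenerate symmetric or skew-symmetric bilinear form $\omega$, $E$ is $\omega$-isotropic (it has an involution $i_E$ with at most one fixed point such that $\omega(e,e')=0$ unless $e'=i_E(e)$), the $E_n$ are $i_E$-stable, and, by convention, if $\omega$ is symmetric then $i_E$ has exactly one fixed point, which lies in every $E_n$; $\mathbf{G}^\omega(E)$ is the subgroup of elements of $\mathbf{G}(E)$ preserving $\omega$. A subset of $\mathbf{G}=\bigcup_n G_n$ is closed if its intersection with each $G_n$ ($G_n=GL(\langle E_n\rangle)$, resp. its subgroup preserving $\omega|_{\langle E_n\rangle}$) is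 Zariski closed. $\mathbf{H}\subset\mathbf{G}$ is the subgroup of elements diagonal in $E$. A splitting Borel subgroup containing $\mathbf{H}$ is a closed subgroup containing $\mathbf{H}$ which is locally solvable (all algebraic subgroups solvable) and maximal with this property; a splitting parabolic subgroup is a closed subgroup containing such a splitting Borel subgroup. $\mathbf{W}$ is the group of permutations $w$ of $E$ fixing all but finitely many elements (and, if $\mathbf{G}=\mathbf{G}^\omega(E)$, commuting with $i_E$). For $w\in\mathbf{W}$, $\hat{w}\in\mathbf{G}$ is a representative of $w$ normalizing $\mathbf{H}$: if $\mathbf{G}=\mathbf{G}(E)$, $\hat{w}$ is the linear extension of $w$; if $\mathbf{G}=\mathbf{G}^\omega(E)$, $\hat{w}\in\mathbf{G}^\omega(E)$ is the linear extension of $e\mapsto\lambda_ew(e)$ for suitable scalars $\lambda_e\in\mathbb{K}^*$. A splitting parabolic subgroup $\mathbf{P}\supset\mathbf{H}$ is the stabilizer in $\mathbf{G}$ of a unique generalized flag $\mathcal{F}$ compatible with $E$ ($\omega$-isotropic if $\mathbf{G}=\mathbf{G}^\omega(E)$); that is, there are a totally ordered set $(A,\preceq_A)$ and a surjection $\sigma_0:E\to A$ such that $\mathcal{F}$ consists of the subspaces $\langle e\in E:\sigma_0(e)\prec_A\alpha\rangle$, $\langle e\in E:\sigma_0(e)\preceq_A\alpha\rangle$ ($\alpha\in A$). Then $\mathbf{W}_{\mathbf{P}}=\{w\in\mathbf{W}:\sigma_0\circ w^{-1}=\sigma_0\}$. *)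

(* Defs.v *)
From HB Require Import structures.
From mathcomp Require Import all_boot all_order all_algebra.
From mathcomp Require Import finmap.
From mathcomp Require Import boolp classical_sets cardinality.
From mathcomp Require Import mpoly.

Set Implicit Arguments.
Unset Strict Implicit.
Unset Printing Implicit Defensive.

Import GRing.Theory.

Local Open Scope classical_set_scope.
Local Open Scope ring_scope.

(* The group of all bijections of a type [T]; the product [f * g] is the
   composite [f \o g].  The inverse is stored with the function, and equality
   is extensional equality of functions (lemma [symP]). *)
Record sym (T : Type) := Sym {
  sym_fun :> T -> T;
  sym_inv : T -> T;
  sym_funK : cancel sym_fun sym_inv;
  sym_invK : cancel sym_inv sym_fun }.

Section SymGroup.
Variable T : Type.
Implicit Types f g h : sym T.

Lemma symP f g : (forall x, f x = g x) -> f = g.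
Proof.
case: f g => [f f' fK f'K] [g g' gK g'K] /= fg.
have efg : f = g by apply: funext.
subst g.
have efg' : f' = g' by apply: funext => x; rewrite -{1}(g'K x) fK.
subst g'.
by congr Sym; apply: Prop_irrelevance.
Qed.

HB.instance Definition _ := gen_eqMixin (sym T).
HB.instance Definition _ := gen_choiceMixin (sym T).

Definition sym_one : sym T := @Sym T id id (fun=> erefl) (fun=> erefl).
Definition sym_mul f g : sym T :=
  Sym (can_comp (@sym_funK _ f) (@sym_funK _ g))
      (can_comp (@sym_invK _ g) (@sym_invK _ f)).
Definition sym_opp f : sym T := Sym (@sym_invK _ f) (@sym_funK _ f).

Fact sym_mulA : associative sym_mul. Proof. by move=> f g h; apply: symP. Qed.
Fact sym_mul1 : left_id sym_one sym_mul. Proof. by move=> f; apply: symP. Qed.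
Fact sym_mulr1 : right_id sym_one sym_mul. Proof. by move=> f; apply: symP. Qed.
Fact sym_mulV : left_inverse sym_one sym_opp sym_mul.
Proof. by move=> f; apply: symP => x; rewrite /= sym_funK. Qed.
Fact sym_mulrV : right_inverse sym_one sym_opp sym_mul.
Proof. by move=> f; apply: symP => x; rewrite /= sym_invK. Qed.

HB.instance Definition _ :=
  isGroup.Build (sym T) sym_mulA sym_mul1 sym_mulr1 sym_mulV sym_mulrV.

End SymGroup.

Section Subgroups.
Variable gT : groupType.
Implicit Types S : set gT.

Definition subgroup S :=
  [/\ S 1%g, forall x y, S x -> S y -> S (x * y)%g & forall x, S x -> S x^-1%g].

Definition derived S : set gT :=
  smallest subgroup [set [~ x, y]%g | x in S & y in S].

Definition solvable_group S := exists k, iter k derived S = [set 1%g].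

Definition double_coset S (x : gT) S' : set gT :=
  [set (y * x * z)%g | y in S & z in S'].

End Subgroups.

Section Bases.
Variables (K : closedFieldType) (V : lmodType K) (E : countType) (b : E -> V).

Definition subspace (U : set V) :=
  U 0 /\ forall (c : K) (u v : V), U u -> U v -> U (c *: u + v).

Definition span (X : set V) : set V := smallest subspace X.

Definition is_basis :=
  span (range b) = setT /\
  forall (s : seq E) (c : E -> K), uniq s ->
    \sum_(e <- s) c e *: b e = 0 -> {in s, forall e, c e = 0}.

(* The filtration starts at index 0 instead of 1. *)
Definition is_filtration (F : nat -> {fset E}) :=
  (forall n, {subset F n <= F n.+1}) /\ (forall e, exists n, e \in F n).

End Bases.

(* The two ind-groups under consideration: [GenLin] stands for G(E), and
   [Isom omega iE] for G^omega(E). *)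
Variant ind_group (K : closedFieldType) (V : lmodType K) (E : countType) :=
  | GenLin
  | Isom of (V -> V -> K) & (E -> E).

Arguments GenLin {K V E}.
Arguments Isom {K V E} _ _.

Section IndGroups.
Variables (K : closedFieldType) (V : lmodType K) (E : countType) (b : E -> V).
Variables (F : nat -> {fset E}) (G : ind_group V E).

Definition isotropic_form (omega : V -> V -> K) (iE : E -> E) :=
  let symmetric_form := forall u v, omega u v = omega v u in
  let skew_form := forall u v, omega u v = - omega v u in
  [/\ (forall u, scalar (omega u)) /\ (forall v, scalar (omega^~ v)),
      forall u, (forall v, omega u v = 0) -> u = 0,
      symmetric_form \/ skew_form &
  [/\ involutive iE /\
      (forall e e', iE e = e -> iE e' = e' -> e = e'),
      forall e e', e' <> iE e -> omega (b e) (b e') = 0,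
      forall n e, e \in F n -> iE e \in F n &
      symmetric_form -> exists2 e, iE e = e & forall n, e \in F n]].

Definition admissible : Prop :=
  if G is Isom omega iE then isotropic_form omega iE else True.

Definition preserves_form (U : set V) (g : V -> V) : Prop :=
  if G is Isom omega _ then
    forall u v, U u -> U v -> omega (g u) (g v) = omega u v
  else True.

Definition ind_set : set (sym V) := [set g : sym V |
  [/\ linear g, finite_set [set e | g (b e) <> b e] & preserves_form setT g]].

Definition span_level n : set V := span (b @` [set` F n]).

Definition level n : set (sym V) := [set g : sym V |
  [/\ linear g, g @` span_level n = span_level n,
      forall e, e \notin F n -> g (b e) = b e
    & preserves_form (span_level n) g]].

Definition matrix_of n (g : V -> V) (M : 'M[K]_#|{: F n}|) :=
  forall j, g (b (val (enum_val j))) = \sum_i M i j *: b (val (enum_val i)).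

(* Zero loci in [level n] of sets of polynomials in the matrix entries;
   inverting the determinant gives no further closed sets. *)
Definition zariski_closed n (Z : set (sym V)) :=
  exists I : set {mpoly K[#|{: F n}| * #|{: F n}|]},
    Z = level n `&` [set g : sym V | exists2 M, @matrix_of n g M &
                       forall p, I p -> p.@[fun k => mxvec M 0 k] = 0].

Definition closed_subgroup (S : set (sym V)) :=
  [/\ subgroup S, S `<=` ind_set &
      forall n, zariski_closed n (S `&` level n)].

Definition algebraic_subgroup (S : set (sym V)) :=
  subgroup S /\ exists n, S `<=` level n /\ zariski_closed n S.

Definition locally_solvable (S : set (sym V)) :=
  forall S', algebraic_subgroup S' -> S' `<=` S -> solvable_group S'.

Definition diag_group : set (sym V) :=
  ind_set `&` [set g : sym V | forall e, exists c : K, g (b e) = c *: b e].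

Definition splitting_borel (B : set (sym V)) :=
  let good S :=
    [/\ closed_subgroup S, diag_group `<=` S & locally_solvable S] in
  good B /\ forall B', good B' -> B `<=` B' -> B' = B.

Definition splitting_parabolic (P : set (sym V)) :=
  closed_subgroup P /\ exists2 B, splitting_borel B & B `<=` P.

Definition weyl : set (sym E) := [set w : sym E |
  finite_set [set e | w e <> e] /\
  if G is Isom _ iE then forall e, w (iE e) = iE (w e) else True].

Definition representative (w : sym E) (g : sym V) :=
  ind_set g /\
  if G is Isom _ _ then
    exists2 c : E -> K, (forall e, c e != 0) & forall e, g (b e) = c e *: b (w e)
  else forall e, g (b e) = b (w e).

Section Flags.
Variables (d : Order.disp_t) (A : orderType d) (sigma : E -> A).

Definition gen_flag : set (set V) := [set X | exists a : A,
  X = span (b @` [set e | (sigma e < a)%O]) \/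
  X = span (b @` [set e | (sigma e <= a)%O])].

Definition orthogonal_space (omega : V -> V -> K) (X : set V) : set V :=
  [set v | forall u, X u -> omega u v = 0].

Definition isotropic_flag : Prop :=
  if G is Isom omega _ then
    forall X, gen_flag X -> gen_flag (orthogonal_space omega X) /\
      orthogonal_space omega (orthogonal_space omega X) = X
  else True.

Definition flag_stabilizer : set (sym V) :=
  ind_set `&` [set g : sym V | forall X, gen_flag X -> g @` X = X].

(* "[P] is the stabilizer of the generalized flag of [sigma]".  Since connectedness
   is not part of the definition of a splitting Borel subgroup, this does not
   follow from [splitting_borel] or [splitting_parabolic]: in the stabilizer of
   <e1,e2> < <e1,e2,e3> < ..., the elements acting on <e1,e2> by monomial
   matrices form a maximal closed locally solvable subgroup containing
   [diag_group] that is not the stabilizer of a flag. *)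
Definition is_flag_of (P : set (sym V)) :=
  [/\ range sigma = setT, isotropic_flag & P = flag_stabilizer].

Definition weyl_of_flag : set (sym E) :=
  weyl `&` [set w : sym E | sigma \o (w^-1)%g = sigma].

End Flags.

End IndGroups.

(* Main.v *)
Require Import Defs.
From HB Require Import structures.
From mathcomp Require Import all_boot all_order all_algebra.
From mathcomp Require Import finmap.
From mathcomp Require Import boolp classical_sets cardinality.
From mathcomp Require Import ring.

(* If the flag of B were not maximal, B would contain an image of SL_2 (standard
   on a pair of basis vectors, standard plus dual on two pairs, or on quadratic
   forms in the orthogonal case), which is perfect; so sigmaB is injective and
   the elements of B are triangular with nonzero diagonal entries.

   Disjointness: if beta w' = w p up to representatives, with beta in B and p in
   P, then beta maps the flag of sigmaP o w'^-1 into that of sigmaP o w^-1; as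
   the e-th coordinate of beta e is nonzero, sigmaP (w^-1 e) <= sigmaP (w'^-1 e)
   for all e, and the converse inequality holds by symmetry.

   Covering: Gauss elimination.  Given g, let e1 be the sigmaB-smallest basis
   vector not yet treated and f a sigmaP-largest vector in the support of
   g^-1 e1.  A transvection (for isometries, an Eichler transformation) in P
   turns g into a map sending f to a multiple of e1, and then one in B clears the
   remaining entries. *)

Set Implicit Arguments.
Unset Strict Implicit.
Unset Printing Implicit Defensive.

Import Order.TTheory GRing.Theory.

Local Open Scope classical_set_scope.
Local Open Scope ring_scope.

(** * Coordinates *)

(** The orders behind the two flags are arbitrary, possibly dense, so neither a length function nor
    an induction along a flag is available. Finiteness replaces them: an element of the group moves
    finitely many basis vectors, hence smallest and largest elements are only taken in finite sets,
    and the elimination is an induction on the number of untreated vectors. The two extremal choices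
    serve the two factors. As [e1] is smallest among the remaining targets, adding multiples of it
    to the others preserves the flag of B; as [f] is largest in its support, replacing it by a
    combination of that support preserves the flag of P. Isometries are treated one dual pair at a
    time: once the images of a pair are settled, orthogonality clears what remains. The self-dual
    vector, if there is one, is left to the end, when its image is forced up to a scalar.
    Characteristic zero enters through the invertibility of 2 and 3, in the commutators of SL_2 and
    in its action on quadratic forms. *)

Lemma sym_mulE (T : Type) (g h : sym T) v : (g * h)%g v = g (h v).
Proof. by []. Qed.

Lemma sym_invE (T : Type) (g : sym T) v : g^-1%g (g v) = v.
Proof. exact: sym_funK. Qed.

Lemma sym_invE' (T : Type) (g : sym T) v : g (g^-1%g v) = v.
Proof. exact: sym_invK. Qed.

Section LinearMaps.
Variables (K : closedFieldType) (V : lmodType K).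
Implicit Types (f g : V -> V) (phi : V -> K).

Lemma linear_fun0 f : linear f -> f 0 = 0.
Proof. by move=> fl; have := fl (-1) 0 0; rewrite scaler0 addr0 scaleN1r addNr. Qed.

Lemma linear_funD f u v : linear f -> f (u + v) = f u + f v.
Proof. by move=> fl; have := fl 1 u v; rewrite !scale1r. Qed.

Lemma linear_funZ f c u : linear f -> f (c *: u) = c *: f u.
Proof. by move=> fl; have := fl c u 0; rewrite (linear_fun0 fl) !addr0. Qed.

Lemma linear_fun_sum f (I : Type) (s : seq I) (F : I -> V) :
  linear f -> f (\sum_(i <- s) F i) = \sum_(i <- s) f (F i).
Proof.
move=> fl; elim: s => [|i s IHs]; first by rewrite !big_nil linear_fun0.
by rewrite !big_cons linear_funD // IHs.
Qed.

Lemma scalar_fun0 phi : scalar phi -> phi 0 = 0.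
Proof.
by move=> fl; have := fl (-1) 0 0; rewrite scaler0 addr0 mulN1r addNr.
Qed.

Lemma scalar_funD phi u v : scalar phi -> phi (u + v) = phi u + phi v.
Proof. by move=> fl; have := fl 1 u v; rewrite scale1r mul1r. Qed.

Lemma scalar_funZ phi c u : scalar phi -> phi (c *: u) = c * phi u.
Proof. by move=> fl; have := fl c u 0; rewrite (scalar_fun0 fl) !addr0. Qed.

Lemma scalar_funB phi u v : scalar phi -> phi (u - v) = phi u - phi v.
Proof.
by move=> fl; rewrite scalar_funD // -scaleN1r scalar_funZ // mulN1r.
Qed.

Lemma scalar_fun_sum phi (I : Type) (s : seq I) (F : I -> V) :
  scalar phi -> phi (\sum_(i <- s) F i) = \sum_(i <- s) phi (F i).
Proof.
move=> fl; elim: s => [|i s IHs]; first by rewrite !big_nil scalar_fun0.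
by rewrite !big_cons scalar_funD // IHs.
Qed.

Lemma linear_comp f g : linear f -> linear g -> linear (fun v => f (g v)).
Proof. by move=> fl gl c u v; rewrite /= gl fl. Qed.

Lemma scalar_comp phi f : scalar phi -> linear f -> scalar (fun v => phi (f v)).
Proof. by move=> fl gl c u v; rewrite /= gl fl. Qed.

Lemma linear_sym_inv (g : sym V) : linear g -> linear g^-1%g.
Proof.
move=> gl c u v; apply: (can_inj (sym_invE' g^-1%g)).
by rewrite invgK gl !sym_invE'.
Qed.

End LinearMaps.

Section Coordinates.
Variables (K : closedFieldType) (V : lmodType K) (E : countType) (b : E -> V).
Hypothesis basis_b : is_basis b.

Lemma basis_expansion v :
  exists X : {fset E}, exists c : E -> K, v = \sum_(e <- X) c e *: b e.
Proof.
have [bT _] := basis_b.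
have : Defs.span (range b) v by rewrite bT.
move/(_ [set v | exists X : {fset E}, exists c : E -> K,
  v = \sum_(e <- X) c e *: b e]); apply; split=> [|_ [e _ <-]].
  split=> [|a u w [X [c ->]] [Y [d ->]]].
    by exists fset0, (fun=> 0); rewrite big_seq_fset0.
  pose c' e := if e \in X then c e else 0.
  pose d' e := if e \in Y then d e else 0.
  exists (X `|` Y)%fset, (fun e => a * c' e + d' e).
  under [RHS]eq_bigr do rewrite scalerDl -scalerA.
  rewrite big_split -scaler_sumr; congr (_ *: _ + _).
    rewrite -(big_fset_incl _ (fsubsetUl X Y)) => [|e _ /negPf eX].
      by rewrite [LHS]big_seq [RHS]big_seq; apply: eq_bigr => e; rewrite /c' => ->.
    by rewrite /c' eX scale0r.
  rewrite -(big_fset_incl _ (fsubsetUr X Y)) => [|e _ /negPf eX].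
    by rewrite [LHS]big_seq [RHS]big_seq; apply: eq_bigr => e; rewrite /d' => ->.
  by rewrite /d' eX scale0r.
exists [fset e]%fset, (fun=> 1).
by rewrite big_seq_fset1 scale1r.
Qed.

(** The chosen finite set may contain indices with coefficient 0, so it is filtered wherever the
    exact support matters. *)
Definition supp v : {fset E} := projT1 (cid (basis_expansion v)).

Definition co v (e : E) : K :=
  if e \in supp v then projT1 (cid (projT2 (cid (basis_expansion v)))) e else 0.

Lemma coE v : v = \sum_(e <- supp v) co v e *: b e.
Proof.
have := projT2 (cid (projT2 (cid (basis_expansion v)))).
rewrite -/(supp v) => {1}->; rewrite [LHS]big_seq [RHS]big_seq.
by apply: eq_bigr => e; rewrite /co => ->.
Qed.

Lemma co_supp v e : e \notin supp v -> co v e = 0.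
Proof. by rewrite /co => /negPf ->. Qed.

Lemma mem_supp v e : co v e != 0 -> e \in supp v.
Proof. by apply: contraR => /co_supp ->. Qed.

Lemma coE_on v (X : {fset E}) : (forall e, co v e != 0 -> e \in X) ->
  v = \sum_(e <- X) co v e *: b e.
Proof.
move=> vX; rewrite {1}(coE v).
rewrite (big_fset_incl _ (fsubsetUl (supp v) X)) => [|e _ /co_supp ->];
  last by rewrite scale0r.
rewrite [RHS](big_fset_incl _ (fsubsetUr (supp v) X)) // => e _ eX.
by have [->|/vX] := eqVneq (co v e) 0; rewrite ?scale0r // (negPf eX).
Qed.

Lemma co_sum (X : {fset E}) (c : E -> K) e :
  co (\sum_(i <- X) c i *: b i) e = if e \in X then c e else 0.
Proof.
set v := \sum_(i <- X) _.
(* Both expansions of [v] are padded by zeros to the union of their index sets, where linear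
   independence can compare them. *)
pose c' i := if i \in X then c i else 0.
have vE : v = \sum_(i <- (X `|` supp v)%fset) c' i *: b i.
  rewrite -(big_fset_incl _ (fsubsetUl X (supp v))) => [|i _ /negPf iX].
    rewrite [LHS]big_seq [RHS]big_seq; apply: eq_bigr => i.
    by rewrite /c' => ->.
  by rewrite /c' iX scale0r.
have vE' : v = \sum_(i <- (X `|` supp v)%fset) co v i *: b i.
  apply: coE_on => i iv; rewrite in_fsetU orbC.
  by apply: contraNT iv; rewrite negb_or => /andP[/co_supp -> _].
have [_ indep] := basis_b.
have := indep _ (fun i => co v i - c' i) (fset_uniq (X `|` supp v)%fset).
under eq_bigr do rewrite scalerBl.
rewrite sumrB -vE -vE' subrr => /(_ erefl) /(_ e).
rewrite in_fsetU -/(c' e); case: (boolP (e \in X)) => eX /=.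
  by move=> /(_ isT) /eqP; rewrite subr_eq0 => /eqP.
case: (boolP (e \in supp v)) => ev; last by rewrite co_supp // /c' (negPf eX).
by move=> /(_ isT) /eqP; rewrite subr_eq0 => /eqP.
Qed.

Lemma co_basis e e' : co (b e) e' = (e' == e)%:R.
Proof.
have -> : b e = \sum_(i <- [fset e]%fset) 1 *: b i.
  by rewrite big_seq_fset1 scale1r.
by rewrite co_sum in_fset1; case: eqP.
Qed.

Lemma co_scalar e : scalar (co^~ e).
Proof.
move=> a u v; set X := (supp u `|` supp v)%fset.
have uX i : co u i != 0 -> i \in X.
  by move=> /mem_supp iu; rewrite in_fsetU iu.
have vX i : co v i != 0 -> i \in X.
  by move=> /mem_supp iv; rewrite in_fsetU iv orbT.
rewrite {1}(coE_on uX) {1}(coE_on vX) scaler_sumr -big_split /=.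
under eq_bigr do rewrite scalerA -scalerDl.
rewrite (co_sum X (fun i => a * co u i + co v i)).
case: ifP => // /negbT eX.
have -> : co u e = 0 by apply: contraNeq eX => /uX.
have -> : co v e = 0 by apply: contraNeq eX => /vX.
by rewrite mulr0 addr0.
Qed.

Lemma coD u v e : co (u + v) e = co u e + co v e.
Proof. exact: scalar_funD (co_scalar e). Qed.

Lemma coB u v e : co (u - v) e = co u e - co v e.
Proof. exact: scalar_funB (co_scalar e). Qed.

Lemma coZ a u e : co (a *: u) e = a * co u e.
Proof. exact: scalar_funZ (co_scalar e). Qed.

Lemma co0 e : co 0 e = 0.
Proof. exact: scalar_fun0 (co_scalar e). Qed.

Lemma co_ext u v : (forall e, co u e = co v e) -> u = v.
Proof.
move=> uv; apply/eqP; rewrite -subr_eq0; apply/eqP.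
by rewrite [LHS]coE big1 // => e _; rewrite coB uv subrr scale0r.
Qed.

Lemma scalar_ext (f g : V -> K) : scalar f -> scalar g ->
  (forall e, f (b e) = g (b e)) -> f =1 g.
Proof.
move=> fl gl fg v; rewrite (coE v) !scalar_fun_sum //.
by apply: eq_bigr => e _; rewrite !scalar_funZ // fg.
Qed.

Lemma basis_neq0 e : b e <> 0.
Proof.
by move=> /(congr1 (co^~ e)); rewrite co_basis eqxx co0 => /eqP; rewrite oner_eq0.
Qed.

(** This turns every later statement about flags into one about vanishing coordinates. *)
Lemma spanE (S : set E) :
  Defs.span (b @` S) = [set v | forall e, co v e != 0 -> S e].
Proof.
apply/seteqP; split=> [v|v vS].
  move/(_ [set v | forall e, co v e != 0 -> S e]); apply.
  split=> [|_ [e Se <-] e']; last first.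
    by rewrite /= co_basis; case: (eqVneq e' e) => [->|_]; rewrite ?eqxx.
  split=> [e|a u w uS wS e]; first by rewrite co0 eqxx.
  rewrite coD coZ; have [u0|/uS //] := eqVneq (co u e) 0.
  have [w0|/wS //] := eqVneq (co w e) 0.
  by rewrite u0 w0 mulr0 addr0 eqxx.
move=> U [[U0 UD] SU]; rewrite (coE v) big_seq.
suff: forall X : seq E, U (\sum_(e <- X) co v e *: b e).
  by rewrite -big_seq; apply.
elim=> [|e X IHX]; first by rewrite big_nil.
rewrite big_cons; have [->|ve] := eqVneq (co v e) 0; first by rewrite scale0r add0r.
by apply: UD => //; apply: SU; exists e => //; apply: vS.
Qed.

Lemma co_linear (f : V -> V) v e : linear f ->
  co (f v) e = \sum_(i <- supp v) co v i * co (f (b i)) e.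
Proof.
move=> fl; rewrite {1}(coE v) linear_fun_sum // (scalar_fun_sum _ _ (co_scalar e)).
by apply: eq_bigr => i _; rewrite linear_funZ // coZ.
Qed.

Lemma co_linear_neq0 (f : V -> V) v e : linear f -> co (f v) e != 0 ->
  exists i, co v i != 0 /\ co (f (b i)) e != 0.
Proof.
move=> fl; rewrite co_linear // => fv; apply: contrapT => nex.
case/eqP: fv; apply: big1 => i _; apply/eqP; rewrite mulf_eq0.
by apply/negPn/negP; rewrite negb_or => /andP[iv ib]; apply: nex; exists i.
Qed.

End Coordinates.

(** * Stabilizers of generalized flags *)

Section Stabilizers.
Variables (K : closedFieldType) (V : lmodType K) (E : countType) (b : E -> V).
Hypothesis basis_b : is_basis b.
Variable G : ind_group V E.
Local Notation co := (co basis_b).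

Lemma ind_setM g h : ind_set b G g -> ind_set b G h -> ind_set b G (g * h)%g.
Proof.
move=> [gl gf gG] [hl hf hG]; split; first exact: linear_comp.
  apply: (@sub_finite_set _ _
    ([set e | g (b e) <> b e] `|` [set e | h (b e) <> b e])).
    move=> e /= ghe; apply: contrapT => /not_orP[/contrapT ge /contrapT he].
    by apply: ghe; rewrite he ge.
  by rewrite finite_setU.
by case: G gG hG => //= omega iE gG hG u v _ _; rewrite gG // hG.
Qed.

Lemma ind_setV g : ind_set b G g -> ind_set b G g^-1%g.
Proof.
move=> [gl gf gG]; split; first exact: linear_sym_inv.
  by apply: sub_finite_set gf => e ge ge'; apply: ge; rewrite -{1}ge' sym_invE.
case: G gG => //= omega iE gG u v _ _.
by rewrite -[LHS]gG // -/(g^-1%g) !sym_invE'.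
Qed.

Lemma ind_set_linear g : ind_set b G g -> linear g.
Proof. by case. Qed.

Section Flag.
Variables (d : Order.disp_t) (A : orderType d) (sigma : E -> A).

Definition triangular (g : V -> V) :=
  forall e e', co (g (b e)) e' != 0 -> (sigma e' <= sigma e)%O.

Lemma flag_stabilizerP g : ind_set b G g ->
  flag_stabilizer b G sigma g <-> triangular g /\ triangular g^-1%g.
Proof.
move=> Gg; have gl := ind_set_linear Gg; have gVl := linear_sym_inv gl.
split=> [[_ gX]|[gt gVt]].
  have Xe e : gen_flag b sigma (Defs.span (b @` [set i | sigma i <= sigma e]%O)).
    by exists (sigma e); right.
  have be e : Defs.span (b @` [set i | sigma i <= sigma e]%O) (b e).
    rewrite (spanE basis_b) => i; rewrite co_basis /=.
    by case: (eqVneq i e) => [->|]; rewrite ?eqxx.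
  split=> e e'.
    have : Defs.span (b @` [set i | sigma i <= sigma e]%O) (g (b e)).
      by rewrite -(gX _ (Xe e)); exists (b e).
    by rewrite (spanE basis_b); apply.
  have := be e; rewrite -{1}(gX _ (Xe e)) => -[u uX <-].
  by rewrite sym_invE; move: uX; rewrite (spanE basis_b); apply.
split=> // X gX.
(* Both kinds of members of the flag are spans of sets closed downwards for [sigma], and only this
   is used: triangularity of [g] gives one inclusion, that of the inverse the other. *)
have [S [lowS ->]] : exists S : set E,
    (forall e e', S e -> (sigma e' <= sigma e)%O -> S e') /\
    X = Defs.span (b @` S).
  case: gX => a [] ->.
    exists [set e | sigma e < a]%O; split=> // e e' /= ea e'e.
    exact: le_lt_trans e'e ea.
  exists [set e | sigma e <= a]%O; split=> // e e' /= ea e'e.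
  exact: le_trans e'e ea.
have stab h : linear h -> triangular h ->
    forall v, Defs.span (b @` S) v -> Defs.span (b @` S) (h v).
  move=> hl ht v; rewrite (spanE basis_b) => vS e /(co_linear_neq0 hl)[i [vi hi]].
  exact: lowS (vS i vi) (ht _ _ hi).
apply/seteqP; split=> [_ [v vS <-]|v vS]; first exact: stab.
by exists (g^-1%g v); [exact: stab | exact: sym_invE'].
Qed.

(** The [e]-th coordinate of [g^-1 (g (b e))] is 1, so it is reached through some [i] occurring in
    [g (b e)]; triangularity of [g] and of its inverse squeezes [sigma i] to [sigma e], and
    injectivity gives [i = e]. *)
Lemma triangular_diag_neq0 g e : injective sigma ->
  flag_stabilizer b G sigma g -> co (g (b e)) e != 0.
Proof.
move=> sigmaI Pg; have Gg : ind_set b G g by case: Pg.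
have [gt gVt] := (flag_stabilizerP Gg).1 Pg.
have gVl := linear_sym_inv (ind_set_linear Gg).
apply/eqP => ge0.
have : co (g^-1%g (g (b e))) e != 0.
  by rewrite sym_invE co_basis eqxx oner_eq0.
move=> /(co_linear_neq0 gVl)[i [gi gVi]].
have /sigmaI ie : sigma i = sigma e.
  by apply/eqP; rewrite eq_le (gt _ _ gi) (gVt _ _ gVi).
by rewrite ie ge0 eqxx in gi.
Qed.

End Flag.

Definition monomial (w : E -> E) (g : V -> V) :=
  forall e, exists2 c : K, c != 0 & g (b e) = c *: b (w e).

Lemma monomialM w w' g g' : linear g ->
  monomial w g -> monomial w' g' -> monomial (w \o w') (g \o g').
Proof.
move=> gl gw gw' e; have [c c0 ge] := gw' e; have [c' c'0 ge'] := gw (w' e).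
exists (c * c'); first by rewrite mulf_neq0.
by rewrite /= ge linear_funZ // ge' scalerA.
Qed.

Lemma monomialV (w : sym E) (g : sym V) : linear g ->
  monomial w g -> monomial w^-1%g g^-1%g.
Proof.
move=> gl gw e; have [c c0 ge] := gw (w^-1%g e).
exists c^-1; first by rewrite invr_eq0.
apply: (can_inj (sym_funK g)); rewrite linear_funZ // ge scalerA mulVf //.
by rewrite scale1r sym_invE' /= (sym_invK w).
Qed.

Lemma representative_monomial w g : representative b G w g -> monomial w g.
Proof.
move=> [_]; case: G => [gw e|omega iE [c c0 gw] e].
  by exists 1; rewrite ?oner_eq0 // scale1r.
by exists (c e).
Qed.

Lemma monomial_co (w : sym E) (g : V -> V) v e : linear g -> monomial w g ->
  co (g v) (w e) != 0 -> co v e != 0.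
Proof.
move=> gl gw /(co_linear_neq0 gl)[i [vi]]; have [c c0 ->] := gw i.
rewrite coZ co_basis (can_eq (sym_funK w)).
by case: (eqVneq e i) => [->//|]; rewrite mulr0 eqxx.
Qed.

(** With [w = 1] this puts diagonal elements into P; with a quotient of two Weyl elements it makes
    double cosets coincide. *)
Lemma monomial_stabilizer d (A : orderType d) (sigma : E -> A) (w : sym E) g :
  ind_set b G g -> monomial w g -> sigma \o w^-1%g = sigma ->
  flag_stabilizer b G sigma g.
Proof.
move=> Gg gw sw; apply/flag_stabilizerP => //.
have {}sw e : sigma (w^-1%g e) = sigma e by rewrite -{2}sw.
have gVw := monomialV (ind_set_linear Gg) gw.
split=> e e'.
  have [c c0 ->] := gw e; rewrite coZ co_basis.
  case: (eqVneq e' (w e)) => [->|]; last by rewrite mulr0 eqxx.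
  by rewrite -sw /= (sym_funK w) lexx.
have [c c0 ->] := gVw e; rewrite coZ co_basis.
by case: (eqVneq e' (w^-1%g e)) => [->|]; rewrite ?mulr0 ?eqxx // sw lexx.
Qed.

End Stabilizers.

(** * Maximality of the flag of a Borel subgroup *)

Section SL2.
Variables (K : fieldType) (gT : groupType) (phi : K -> K -> K -> K -> gT).
Hypotheses (two_neq0 : 2 != 0 :> K) (three_neq0 : 3 != 0 :> K).
Hypothesis phiM : forall a b c d a' b' c' d' : K,
  a * d - b * c = 1 -> a' * d' - b' * c' = 1 ->
  (phi a b c d * phi a' b' c' d')%g =
  phi (a * a' + b * c') (a * b' + b * d') (c * a' + d * c') (c * b' + d * d').

Lemma derived_subgroup (S : set gT) : subgroup (derived S).
Proof.
split=> [T [[]] //|x y Sx Sy T sT|x Sx T sT].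
  by have [[_ TM _] _] := sT; apply: TM; [apply: Sx | apply: Sy].
by have [[_ _ TV] _] := sT; apply: TV; apply: Sx.
Qed.

Lemma derived_comm (S : set gT) x y : S x -> S y -> derived S [~ x, y]%g.
Proof. by move=> Sx Sy T [_]; apply; exists x => //; exists y. Qed.

Let phi1 : phi 1 0 0 1 = 1%g.
Proof.
(* An idempotent of a group is trivial. *)
apply: (mulgI (phi 1 0 0 1)); rewrite phiM ?mulg1; try by ring.
by congr phi; ring.
Qed.

(* Every elementary matrix is, up to scaling its parameter, its own commutator
   with [diag(2, 1/2)], which is itself a product of elementary matrices. *)
Lemma SL2_not_solvable (S : set gT) : subgroup S ->
  (forall a b c d : K, a * d - b * c = 1 -> S (phi a b c d)) ->
  solvable_group S -> phi 1 1 0 1 = 1%g.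
Proof.
move=> sS Sphi [k Sk].
pose h := phi 2 0 0 2^-1; pose h' := phi 2^-1 0 0 2.
have hV : (h^-1)%g = h'.
  apply: (mulgI h); rewrite mulgV phiM; try by field.
  by rewrite -phi1; congr phi; field.
have step (D : set gT) : subgroup D ->
    (forall t, D (phi 1 t 0 1) /\ D (phi 1 0 t 1)) -> D h.
  move=> [_ DM _] Dxy.
  (* The two triple products are the Weyl elements with rows (0, 2), (-1/2, 0) and (0, -1), (1,
     0). *)
  have -> : h = (phi 1 2 0 1 * phi 1 0 (- 2^-1) 1 * phi 1 2 0 1 *
                (phi 1 (-1) 0 1 * phi 1 0 1 1 * phi 1 (-1) 0 1))%g.
    by rewrite !phiM; [congr phi; field|field..].
  have Dx t := (Dxy t).1; have Dy t := (Dxy t).2.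
  exact: (DM _ _ (DM _ _ (DM _ _ (Dx _) (Dy _)) (Dx _))
                 (DM _ _ (DM _ _ (Dx _) (Dy _)) (Dx _))).
suff: subgroup (iter k (@derived gT) S) /\ forall t,
    iter k (@derived gT) S (phi 1 t 0 1) /\ iter k (@derived gT) S (phi 1 0 t 1).
  by rewrite Sk => -[_ /(_ 1)[]].
elim: k {Sk} => [|k [IHs IHk]].
  by split=> // t; split; apply: Sphi; ring.
split=> [|t]; first exact: derived_subgroup.
have Dh := step _ IHs IHk; rewrite iterS; split.
  (* Conjugation by [h] divides an upper parameter by 4 and multiplies a lower one by 4, so the
     commutator of the parameter [s] with [h] has parameter [-3s/4], respectively [3s]. Solving for
     [t] gives the constants here and below. *)
  have [Dx _] := IHk (- (4 * t / 3)).
  suff -> : phi 1 t 0 1 = [~ phi 1 (- (4 * t / 3)) 0 1, h]%g.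
    exact: (derived_comm Dx Dh).
  have xV : ((phi 1 (- (4 * t / 3)) 0 1)^-1)%g = phi 1 (4 * t / 3) 0 1.
    apply: (mulgI (phi 1 (- (4 * t / 3)) 0 1)); rewrite mulgV phiM; try by field.
    by rewrite -phi1; congr phi; field.
  rewrite commgEl conjgE xV hV !phiM; try by field; rewrite ?three_neq0 ?two_neq0.
  by congr phi; field; rewrite three_neq0 two_neq0.
have [_ Dy] := IHk (t / 3).
suff -> : phi 1 0 t 1 = [~ phi 1 0 (t / 3) 1, h]%g.
  exact: (derived_comm Dy Dh).
have xV : ((phi 1 0 (t / 3) 1)^-1)%g = phi 1 0 (- (t / 3)) 1.
  apply: (mulgI (phi 1 0 (t / 3) 1)); rewrite mulgV phiM; try by field.
  by rewrite -phi1; congr phi; field.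
rewrite commgEl conjgE xV hV !phiM; try by field; rewrite ?three_neq0 ?two_neq0.
by congr phi; field; rewrite three_neq0 two_neq0.
Qed.

End SL2.

(** * Levels of the filtration *)

Section Levels.
Variables (K : closedFieldType) (V : lmodType K) (E : countType) (b : E -> V).
Hypothesis basis_b : is_basis b.
Variables (F : nat -> {fset E}) (G : ind_group V E).
Hypothesis filtF : is_filtration F.

Lemma filtration_le m n : (m <= n)%N -> {subset F m <= F n}.
Proof.
have [FS _] := filtF; move=> /subnK <-; elim: (n - m)%N => [|k IHk] //= e /IHk.
by rewrite addSn => /FS.
Qed.

Lemma filtration_seq (s : seq E) : exists n, {subset s <= F n}.
Proof.
have [_ FE] := filtF; elim: s => [|e s [n sn]]; first by exists 0.
have [m em] := FE e; exists (maxn m n) => x; rewrite inE => /orP[/eqP->|/sn].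
  exact: filtration_le (leq_maxl m n) _ em.
exact: filtration_le (leq_maxr m n) _.
Qed.

Lemma level_subgroup n : subgroup (level b F G n).
Proof.
split=> [|g h [gl gF gb gG] [hl hF hb hG]|g [gl gF gb gG]].
- split=> //; last by case: G.
  by apply/seteqP; split=> [_ [v vF <-] //|v vF]; exists v.
- split; first exact: linear_comp.
  + by rewrite -[RHS]gF -[X in _ = _ @` X]hF -image_comp.
  + by move=> e eF; rewrite sym_mulE hb // gb.
  case: G gG hG => //= omega iE gG hG u v uF vF.
  by rewrite gG ?hG // -hF; [exists u | exists v].
have gVF v : span_level b F n v -> span_level b F n (g^-1%g v).
  by rewrite -{1}gF => -[u uF <-]; rewrite sym_invE.
split; first exact: linear_sym_inv.
- apply/seteqP; split=> [_ [v vF <-]|v vF]; first exact: gVF.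
  exists (g v); last exact: sym_invE.
  by rewrite -gF; exists v.
- by move=> e eF; rewrite -{1}(gb e eF) sym_invE.
case: G gG => //= omega iE gG u v uF vF.
by rewrite -[LHS]gG; [rewrite -/(g^-1%g) !sym_invE'|exact: gVF..].
Qed.

End Levels.

(** * The form in an isotropic basis *)

Section Form.
Variables (K : closedFieldType) (V : lmodType K) (E : countType) (b : E -> V).
Hypothesis basis_b : is_basis b.
Variables (F : nat -> {fset E}) (omega : V -> V -> K) (iE : E -> E).
Hypothesis iso : isotropic_form b F omega iE.
Local Notation co := (co basis_b).

Lemma form_scalarr u : scalar (omega u).
Proof. by case: iso => -[]. Qed.

Lemma form_scalarl v : scalar (omega^~ v).
Proof. by case: iso => -[]. Qed.

Lemma iE_invol : involutive iE.
Proof. by case: iso => _ _ _ [[]]. Qed.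

Lemma iE_fixed_unique e e' : iE e = e -> iE e' = e' -> e = e'.
Proof. by case: iso => _ _ _ [[_ fixI] _ _ _]; apply: fixI. Qed.

Lemma form_basis0 e e' : e' <> iE e -> omega (b e) (b e') = 0.
Proof. by case: iso => _ _ _ [_ om0 _ _]; apply: om0. Qed.

Lemma form_basisr e v : omega (b e) v = co v (iE e) * omega (b e) (b (iE e)).
Proof.
move: v; apply: (scalar_ext basis_b) => [|a u v|e']; first exact: form_scalarr.
  by rewrite coD coZ mulrDl mulrA.
rewrite co_basis; case: (eqVneq (iE e) e') => [->|/eqP ne]; first by rewrite mul1r.
by rewrite mul0r form_basis0 // => /esym.
Qed.

Lemma form_basisl v e : omega v (b e) = co v (iE e) * omega (b (iE e)) (b e).
Proof.
move: v; apply: (scalar_ext basis_b) => [|a u v|e']; first exact: form_scalarl.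
  by rewrite coD coZ mulrDl mulrA.
rewrite co_basis; case: (eqVneq (iE e) e') => [->|/eqP ne]; first by rewrite mul1r.
by rewrite mul0r form_basis0 // => ee'; apply: ne; rewrite ee' iE_invol.
Qed.

Lemma form_basis_neq0 e : omega (b e) (b (iE e)) != 0.
Proof.
case: iso => _ nondeg _ _; apply/eqP => e0; apply: (basis_neq0 basis_b (e := e)).
by apply: nondeg => v; rewrite form_basisr e0 mulr0.
Qed.

(** The sign [eps] lets one computation cover symmetric and skew-symmetric forms. *)
Lemma form_epsilon : exists2 eps : K, eps = 1 \/ eps = -1 &
  forall u v, omega u v = eps * omega v u.
Proof.
case: iso => _ _ [sym|skew] _.
  by exists 1 => [|u v]; [left | rewrite mul1r].
by exists (-1) => [|u v]; [right | rewrite mulN1r].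
Qed.

End Form.

(** * Automorphisms supported on a finite block of basis vectors *)

Section Blocks.
Variables (K : closedFieldType) (V : lmodType K) (E : countType) (b : E -> V).
Hypothesis basis_b : is_basis b.
Local Notation co := (co basis_b).
Variables (m : nat) (x : 'I_m -> E).
Hypothesis x_inj : injective x.

Let cv v : 'cV[K]_m := \col_j co v (x j).
Let emb (u : 'cV[K]_m) : V := \sum_i u i 0 *: b (x i).

Let embD u w : emb (u + w) = emb u + emb w.
Proof. by rewrite -big_split; apply: eq_bigr => i _; rewrite mxE scalerDl. Qed.

Let embZ a u : emb (a *: u) = a *: emb u.
Proof. by rewrite scaler_sumr; apply: eq_bigr => i _; rewrite mxE scalerA. Qed.

Let co_emb u e : co (emb u) e = \sum_i u i 0 * (e == x i)%:R.
Proof.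
rewrite (scalar_fun_sum _ _ (co_scalar basis_b e)).
by apply: eq_bigr => i _; rewrite coZ co_basis.
Qed.

Let cv_linear a u w : cv (a *: u + w) = a *: cv u + cv w.
Proof. by apply/colP => i; rewrite !mxE coD coZ. Qed.

Let cv_emb u : cv (emb u) = u.
Proof.
apply/colP => j; rewrite mxE co_emb (bigD1 j) //= eqxx mulr1 big1 ?addr0 // => i ij.
by rewrite (inj_eq x_inj) eq_sym (negPf ij) mulr0.
Qed.

(** The correction term replaces the block coordinates [cv v] by [M *m cv v] and leaves all others
    alone, so no complement of the block has to be named. *)
Definition block (M : 'M[K]_m) (v : V) : V := v + emb (M *m cv v - cv v).

Let cv_block M v : cv (block M v) = M *m cv v.
Proof.
have := cv_linear 1 v (emb (M *m cv v - cv v)).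
by rewrite !scale1r cv_emb => ->; rewrite addrC subrK.
Qed.

Lemma blockM M N v : block M (block N v) = block (M *m N) v.
Proof.
rewrite {1}/block cv_block /block -addrA -embD; congr (_ + emb _).
by rewrite addrC mulmxA subrKA.
Qed.

Lemma block1 v : block 1%:M v = v.
Proof. by rewrite /block mul1mx subrr -(scale0r 0) embZ scale0r addr0. Qed.

Lemma block_linear M : linear (block M).
Proof.
move=> a u v; rewrite /block cv_linear scalerDr addrACA -embZ -embD.
congr (_ + emb _); rewrite mulmxDr -scalemxAr scalerBr.
by rewrite opprD addrACA.
Qed.

Lemma block_out M e : (forall i, e != x i) -> block M (b e) = b e.
Proof.
move=> ex; have -> : block M (b e) = block 1%:M (b e); last exact: block1.
suff cv0 : cv (b e) = 0 by rewrite /block cv0 !mulmx0.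
by apply/colP => i; rewrite !mxE co_basis eq_sym (negPf (ex i)).
Qed.

Lemma co_block_basis M i j : co (block M (b (x j))) (x i) = M i j.
Proof.
have /colP/(_ i) := cv_block M (b (x j)); rewrite mxE => ->.
rewrite mxE (bigD1 j) //= mxE co_basis eqxx mulr1 big1 ?addr0 // => k kj.
by rewrite mxE co_basis (inj_eq x_inj) (negPf kj) mulr0.
Qed.

Lemma block_span M (S : set E) v : (forall i, S (x i)) ->
  Defs.span (b @` S) v -> Defs.span (b @` S) (block M v).
Proof.
move=> Sx; rewrite !(spanE basis_b) => vS e.
rewrite coD co_emb; have [v0|/vS //] := eqVneq (co v e) 0.
rewrite v0 add0r => ne; apply: contrapT => nSe; case/eqP: ne.
apply: big1 => i _; case: (eqVneq e (x i)) => [ei|_]; last by rewrite mulr0.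
by case: nSe; rewrite ei.
Qed.

Lemma block_triangular d (A : orderType d) (sigma : E -> A) (M : 'M[K]_m) :
  (forall i j, M i j != 0 -> (sigma (x i) <= sigma (x j))%O) ->
  triangular basis_b sigma (block M).
Proof.
move=> Mt e e'; case: (pselect (exists j, e = x j)) => [[j ->]|xe]; last first.
  have ex i : e != x i by apply/eqP => ei; apply: xe; exists i.
  rewrite block_out // co_basis.
  by case: (eqVneq e' e) => [->|]; rewrite ?eqxx.
case: (pselect (exists i, e' = x i)) => [[i ->]|xe'].
  by rewrite co_block_basis => /Mt.
rewrite coD co_emb big1 ?addr0; last first.
  move=> i _; case: (eqVneq e' (x i)) => [ei|_]; last by rewrite mulr0.
  by case: xe'; exists i.
by rewrite co_basis; case: (eqVneq e' (x j)) => [->|]; rewrite ?eqxx.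
Qed.

(** As the block is stable under [iE], pairing one of its vectors with [v] sees only the block
    coordinates of [v]. The difference of the two sides is thus a matrix expression in the Gram
    matrix [J], and it cancels by [M^T *m J *m M = J]. *)
Lemma block_preserves F (omega : V -> V -> K) (iE : E -> E) (M : 'M[K]_m) :
  isotropic_form b F omega iE -> (forall i, exists j, iE (x i) = x j) ->
  let J := \matrix_(i, j) omega (b (x i)) (b (x j)) in
  M^T *m J *m M = J ->
  forall u v, omega (block M u) (block M v) = omega u v.
Proof.
move=> iso xi J MJ.
have omr := form_scalarr iso; have oml := form_scalarl iso.
have embl u v : omega (emb u) v = (u^T *m J *m cv v) 0 0.
  rewrite -mulmxA mxE (scalar_fun_sum _ _ (oml v)); apply: eq_bigr => i _.
  rewrite (scalar_funZ _ _ (oml v)) !mxE; congr (_ * _).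
  have [j ij] := xi i.
  rewrite (form_basisr basis_b iso) (bigD1 j) //= big1 ?addr0 => [|k kj].
    by rewrite !mxE mulrC ij.
  by rewrite mxE (form_basis0 iso) ?mul0r // ij; apply/eqP; rewrite (inj_eq x_inj).
have embr u v : omega v (emb u) = ((cv v)^T *m J *m u) 0 0.
  rewrite mxE (scalar_fun_sum _ _ (omr v)); apply: eq_bigr => i _.
  rewrite (scalar_funZ _ _ (omr v)) mulrC; congr (_ * _); rewrite mxE.
  have [j ij] := xi i.
  rewrite (form_basisl basis_b iso) (bigD1 j) //= big1 ?addr0 => [|k kj].
    by rewrite !mxE ij.
  rewrite !mxE (form_basis0 iso) ?mulr0 // => ik; case/eqP: kj; apply: x_inj.
  by rewrite -ij ik (iE_invol iso).
move=> u v; rewrite /block (scalar_funD _ _ (oml _)) !(scalar_funD _ _ (omr _)).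
rewrite !embr embl cv_emb -!addrA -[RHS]addr0; congr (_ + _).
have mxD (A B : 'M[K]_1) : A 0 0 + B 0 0 = (A + B) 0 0 by rewrite mxE.
rewrite !mxD; transitivity ((0 : 'M[K]_1) 0 0); last by rewrite mxE.
congr (fun_of_matrix _ 0 0).
rewrite !raddfB /= !mulmxBl trmx_mul -!mulmxA.
rewrite [M^T *m (J *m (M *m _))]mulmxA [(M^T *m J) *m _]mulmxA MJ.
set q := _ *m (M^T *m _) - _.
by rewrite [q + _]addrC subrK addrA subrK subrr.
Qed.

End Blocks.

Section BlockGroup.
Variables (K : closedFieldType) (V : lmodType K) (E : countType) (b : E -> V).
Hypothesis basis_b : is_basis b.
Local Notation co := (co basis_b).
Variables (m : nat) (x : 'I_m -> E).
Hypothesis x_inj : injective x.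
Local Notation block := (block basis_b x).

Let unit_or_one (M : 'M[K]_m) := if M \in unitmx then M else 1%:M.

Let unit_or_oneP M : unit_or_one M \in unitmx.
Proof. by rewrite /unit_or_one; case: ifP => // _; rewrite unitmx1. Qed.

Let block_symK M :
  cancel (block (unit_or_one M)) (block (invmx (unit_or_one M))).
Proof. by move=> v; rewrite blockM // mulVmx // block1. Qed.

Let block_symVK M :
  cancel (block (invmx (unit_or_one M))) (block (unit_or_one M)).
Proof. by move=> v; rewrite blockM // mulmxV // block1. Qed.

(* The automorphism acting as [M] on the span of the [b (x i)] and trivially on
   the other basis vectors; it is the identity if [M] is not invertible. *)
Definition block_sym M : sym V := Sym (block_symK M) (block_symVK M).

Lemma block_symE M v : M \in unitmx -> block_sym M v = block M v.
Proof. by move=> Mu; rewrite /= /unit_or_one Mu. Qed.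

Lemma block_symM M N : M \in unitmx -> N \in unitmx ->
  (block_sym M * block_sym N)%g = block_sym (M *m N).
Proof.
move=> Mu Nu; apply: symP => v; rewrite sym_mulE !block_symE //.
  by rewrite blockM.
by rewrite unitmx_mul Mu.
Qed.

Lemma block_symV M : M \in unitmx -> (block_sym M)^-1%g = block_sym (invmx M).
Proof.
move=> Mu; apply: (mulgI (block_sym M)); rewrite mulgV block_symM ?unitmx_inv //.
by apply: symP => v; rewrite mulmxV // block_symE ?unitmx1 // block1.
Qed.

Variables (F : nat -> {fset E}) (G : ind_group V E).
Hypothesis filtF : is_filtration F.
Hypothesis admG : admissible b F G.

Definition block_isometry (M : 'M[K]_m) : Prop :=
  if G is Isom omega iE then
    let J := \matrix_(i, j) omega (b (x i)) (b (x j)) in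
    (forall i, exists j, iE (x i) = x j) /\ M^T *m J *m M = J
  else True.

Lemma block_sym_preserves M U : M \in unitmx -> block_isometry M ->
  preserves_form G U (block_sym M).
Proof.
rewrite /block_isometry; case: G admG => // omega iE iso Mu [xi MJ] u v _ _.
by rewrite !block_symE //; apply: block_preserves iso xi MJ u v.
Qed.

Lemma block_sym_ind M : M \in unitmx -> block_isometry M ->
  ind_set b G (block_sym M).
Proof.
move=> Mu MG; split; last exact: block_sym_preserves.
  by move=> a u v; rewrite !block_symE //; apply: block_linear.
apply: (@sub_finite_set _ _ [set` [fset x i | i in 'I_m]%fset]) => // e ne.
have {}ne : block M (b e) <> b e by rewrite -block_symE.
apply/imfsetP => /=; apply: contrapT => ex; apply: ne; apply: block_out => i.
by apply/eqP => ei; apply: ex; exists i.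
Qed.

Lemma block_sym_level M n : M \in unitmx -> block_isometry M ->
  (forall i, x i \in F n) -> level b F G n (block_sym M).
Proof.
move=> Mu MG xF; split; last exact: block_sym_preserves.
- by move=> a u v; rewrite !block_symE //; apply: block_linear.
- apply/seteqP; split=> [_ [v vF <-]|v vF].
    by rewrite block_symE //; apply: block_span.
  exists (block_sym (invmx M) v).
    by rewrite block_symE ?unitmx_inv //; apply: block_span.
  by rewrite -block_symV // sym_invE'.
move=> e eF; rewrite block_symE // block_out // => i.
by apply: contraNneq eF => ->.
Qed.

(** The common contradiction behind every coincidence of [sigma] on the block. The image of SL_2
    need not be shown algebraic: it lies in the intersection of [B] with a level, which is closed by
    hypothesis and hence solvable. *)
Lemma SL2_block_false (two_neq0 : 2 != 0 :> K) (three_neq0 : 3 != 0 :> K)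
    d (A : orderType d) (sigma : E -> A) (B : set (sym V))
    (rho : K -> K -> K -> K -> 'M[K]_m) :
  closed_subgroup b F G B -> locally_solvable b F G B ->
  B = flag_stabilizer b G sigma ->
  rho 1 0 0 1 = 1%:M -> rho 1 1 0 1 <> 1%:M ->
  (forall p q r s p' q' r' s' : K, p * s - q * r = 1 -> p' * s' - q' * r' = 1 ->
     rho p q r s *m rho p' q' r' s' =
     rho (p * p' + q * r') (p * q' + q * s') (r * p' + s * r') (r * q' + s * s')) ->
  (forall p q r s : K, p * s - q * r = 1 -> block_isometry (rho p q r s)) ->
  (forall (p q r s : K) i j, p * s - q * r = 1 -> rho p q r s i j != 0 ->
     (sigma (x i) <= sigma (x j))%O) ->
  False.
Proof.
move=> [sB BG Bcl] Bsolv BE rho1 rho_ne rhoM rhoG rho_tri.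
have rhoMV (p q r s : K) : p * s - q * r = 1 ->
    rho p q r s *m rho s (- q) (- r) p = 1%:M.
  move=> det1; rewrite rhoM //; last by rewrite mulrNN [s * p]mulrC.
  by rewrite -rho1; congr rho; rewrite -?det1; ring.
have rhoU (p q r s : K) : p * s - q * r = 1 -> rho p q r s \in unitmx.
  by move=> /rhoMV /mulmx1_unit[].
have rhoV (p q r s : K) : p * s - q * r = 1 ->
    invmx (rho p q r s) = rho s (- q) (- r) p.
  move=> det1; have rU := rhoU _ _ _ _ det1.
  by rewrite -[RHS](mulKmx rU) rhoMV // mulmx1.
have [n xn] := filtration_seq filtF [seq x i | i : 'I_m].
have {}xn i : x i \in F n by apply: xn; apply: map_f; rewrite mem_enum.
pose phi p q r s := block_sym (rho p q r s).
have S_phi (p q r s : K) : p * s - q * r = 1 -> (B `&` level b F G n) (phi p q r s).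
  move=> det1; have rU := rhoU _ _ _ _ det1; have rG := rhoG _ _ _ _ det1.
  have det1' : s * p - - q * - r = 1 by rewrite mulrNN mulrC.
  split; last exact: block_sym_level.
  have Gphi : ind_set b G (phi p q r s) by exact: block_sym_ind.
  rewrite BE; apply/(flag_stabilizerP basis_b) => //; split.
    move=> e e'; rewrite block_symE //; apply: block_triangular => // i j.
    exact: rho_tri.
  rewrite block_symV // rhoV // => e e'; rewrite block_symE ?rhoU //.
  by apply: block_triangular => // i j; apply: rho_tri.
have sS : subgroup (B `&` level b F G n).
  have [B1 BM BV] := sB; have [L1 LM LV] := level_subgroup b F G n.
  split=> [|g h [Bg Lg] [Bh Lh]|g [Bg Lg]]; first by split.
    by split; [apply: BM | apply: LM].
  by split; [apply: BV | apply: LV].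
have phiM (p q r s p' q' r' s' : K) : p * s - q * r = 1 -> p' * s' - q' * r' = 1 ->
    (phi p q r s * phi p' q' r' s')%g =
    phi (p * p' + q * r') (p * q' + q * s') (r * p' + s * r') (r * q' + s * s').
  by move=> det1 det1'; rewrite /phi block_symM ?rhoU // rhoM.
have : phi 1 1 0 1 = 1%g.
  apply: (SL2_not_solvable two_neq0 three_neq0 phiM sS S_phi).
  apply: Bsolv; last by move=> g [].
  by split=> //; exists n; split; [move=> g [] | exact: Bcl].
move=> phi1; apply: rho_ne; apply/matrixP => i j.
rewrite -(co_block_basis basis_b x_inj) -block_symE ?rhoU ?mul0r ?mulr0 ?subr0 ?mulr1 //.
rewrite -/(phi 1 1 0 1) phi1 /= co_basis (inj_eq x_inj).
by rewrite mxE.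
Qed.

End BlockGroup.

(** * Duality on isotropic flags *)

Section IsotropicFlags.
Variables (K : closedFieldType) (V : lmodType K) (E : countType) (b : E -> V).
Hypothesis basis_b : is_basis b.
Variables (F : nat -> {fset E}) (omega : V -> V -> K) (iE : E -> E).
Hypothesis iso : isotropic_form b F omega iE.
Variables (d : Order.disp_t) (A : orderType d) (sigma : E -> A).
Hypothesis isoflag : isotropic_flag b (Isom omega iE) sigma.

(** The orthogonal of the member spanned by the vectors up to [e] contains [b (iE e')] but not
    [b (iE e)]; being a member of the flag itself, it is spanned by a set closed downwards. *)
Lemma isotropic_flag_lt e e' :
  (sigma e < sigma e')%O -> (sigma (iE e') < sigma (iE e))%O.
Proof.
move=> ee'; pose X := Defs.span (b @` [set i | sigma i <= sigma e]%O).
have [perpX _] := isoflag (ex_intro _ (sigma e) (or_intror (erefl X))).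
have Xe' : orthogonal_space omega X (b (iE e')).
  move=> u; rewrite /X (spanE basis_b) => uX.
  rewrite (form_basisl basis_b iso) (iE_invol iso).
  have [->|/uX /=] := eqVneq (co basis_b u e') 0; first by rewrite mul0r.
  by rewrite leNgt ee'.
have Xe : ~ orthogonal_space omega X (b (iE e)).
  move=> /(_ (b e)) H; have /eqP := form_basis_neq0 basis_b iso e; apply; apply: H.
  rewrite /X (spanE basis_b) => i; rewrite co_basis /=.
  by case: (eqVneq i e) => [->|]; rewrite ?eqxx.
case: perpX => a [] XE; move: Xe' Xe; rewrite XE !(spanE basis_b) => Xe' Xe.
  have /= e'a := Xe' (iE e') _; rewrite co_basis eqxx oner_eq0 in e'a.
  rewrite ltNge; apply/negP => le; apply: Xe => i; rewrite co_basis /=.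
  case: (eqVneq i (iE e)) => [-> _|]; last by rewrite eqxx.
  exact: le_lt_trans le (e'a isT).
have /= e'a := Xe' (iE e') _; rewrite co_basis eqxx oner_eq0 in e'a.
rewrite ltNge; apply/negP => le; apply: Xe => i; rewrite co_basis /=.
case: (eqVneq i (iE e)) => [-> _|]; last by rewrite eqxx.
exact: le_trans le (e'a isT).
Qed.

Lemma isotropic_flag_le e e' :
  (sigma e <= sigma e')%O -> (sigma (iE e') <= sigma (iE e))%O.
Proof.
move=> le; rewrite leNgt; apply/negP => /isotropic_flag_lt.
by rewrite !(iE_invol iso) ltNge le.
Qed.

Lemma isotropic_flag_eq e e' :
  sigma e = sigma e' -> sigma (iE e) = sigma (iE e').
Proof. by move=> ee'; apply/eqP; rewrite eq_le !isotropic_flag_le ?ee'. Qed.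

(** The involution reverses the order of the classes, so at most one class is self-dual. *)
Lemma isotropic_flag_fixed e e0 : iE e0 = e0 -> sigma e = sigma (iE e) ->
  sigma e0 = sigma e.
Proof.
move=> e00 ee; case: (ltgtP (sigma e0) (sigma e)) => // /[dup] lt.
  by move=> /isotropic_flag_lt; rewrite e00 -ee ltNge ltW.
by move=> /isotropic_flag_lt; rewrite e00 -ee ltNge ltW.
Qed.

End IsotropicFlags.

(** * Excluding repeated values of [sigma] for a Borel subgroup *)

Section BorelInjective.
Variables (K : closedFieldType) (V : lmodType K) (E : countType) (b : E -> V).
Hypothesis charK : [pchar K]%R =i pred0.
Hypothesis basis_b : is_basis b.
Variables (F : nat -> {fset E}).
Hypothesis filtF : is_filtration F.
Variables (d : Order.disp_t) (A : orderType d) (sigma : E -> A).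

Let natK_neq0 n : n.+1%:R != 0 :> K.
Proof. by rewrite ((pcharf0P K).1 charK). Qed.

Definition mx_of_rows m (l : seq (seq K)) : 'M[K]_m :=
  \matrix_(i, j) nth 0 (nth [::] l i) j.

Section General.
Variable B : set (sym V).
Hypotheses (closedB : closed_subgroup b F GenLin B).
Hypotheses (solvB : locally_solvable b F GenLin B).
Hypothesis BE : B = flag_stabilizer b GenLin sigma.

Lemma borel_flag_inj_gen : injective sigma.
Proof.
move=> e e' ee'; apply: contrapT => /eqP ne.
pose x (i : 'I_2) := nth e [:: e; e'] i.
have x_inj : injective x.
  move=> i j /eqP; rewrite nth_uniq //= ?inE ?ne //; first by move/eqP/val_inj.
have sx i : sigma (x i) = sigma e by rewrite /x; case: i => [[|[|//]] ?].
apply: (@SL2_block_false _ _ _ _ basis_b _ x x_inj F GenLin filtF I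
  (natK_neq0 1) (natK_neq0 2) _ _ sigma B
  (fun p q r s => mx_of_rows 2 [:: [:: p; q]; [:: r; s]]) closedB solvB BE).
- by apply/matrixP => i j; rewrite !mxE; case: i j => [[|[|//]] ?] [[|[|//]] ?].
- move=> /matrixP/(_ 0 1); rewrite !mxE /= => /eqP.
  by rewrite oner_eq0.
- move=> p q r s p' q' r' s' _ _; apply/matrixP => i j.
  rewrite !mxE !big_ord_recl big_ord0 !mxE.
  by case: i j => [[|[|//]] ?] [[|[|//]] ?]; rewrite /= addr0.
- by [].
by move=> p q r s i j _ _; rewrite !sx.
Qed.

End General.

Section Isometries.
Variables (omega : V -> V -> K) (iE : E -> E).
Hypothesis iso : isotropic_form b F omega iE.
Hypothesis isoflag : isotropic_flag b (Isom omega iE) sigma.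
Variable B : set (sym V).
Hypotheses (closedB : closed_subgroup b F (Isom omega iE) B).
Hypotheses (solvB : locally_solvable b F (Isom omega iE) B).
Hypothesis BE : B = flag_stabilizer b (Isom omega iE) sigma.

Let SL2_block_isom m x (x_inj : injective x) rho :=
  @SL2_block_false _ _ _ _ basis_b m x x_inj F (Isom omega iE) filtF iso
  (natK_neq0 1) (natK_neq0 2) _ _ sigma B rho closedB solvB BE.

Let formE u v :
  omega (b u) (b v) = if v == iE u then omega (b u) (b (iE u)) else 0.
Proof.
by case: eqVneq => [->//|/eqP ne]; rewrite (form_basis0 iso).
Qed.

(** In dimension two the symplectic group is SL_2 itself. *)
Lemma borel_flag_dual_neq_skew e : (forall u v, omega u v = - omega v u) ->
  iE e != e -> sigma e != sigma (iE e).
Proof.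
move=> skew; rewrite eq_sym => ne; apply/eqP => ee'.
pose x (i : 'I_2) := nth e [:: e; iE e] i.
have x_inj : injective x.
  move=> i j /eqP; rewrite nth_uniq //= ?inE ?ne //; first by move/eqP/val_inj.
have sx i : sigma (x i) = sigma e by rewrite /x; case: i => [[|[|//]] ?].
apply: (SL2_block_isom x_inj
  (rho := fun p q r s => mx_of_rows 2 [:: [:: p; q]; [:: r; s]])).
- by apply/matrixP => i j; rewrite !mxE; case: i j => [[|[|//]] ?] [[|[|//]] ?].
- move=> /matrixP/(_ 0 1); rewrite !mxE /= => /eqP.
  by rewrite oner_eq0.
- move=> p q r s p' q' r' s' _ _; apply/matrixP => i j.
  rewrite !mxE !big_ord_recl big_ord0 !mxE.
  by case: i j => [[|[|//]] ?] [[|[|//]] ?]; rewrite /= addr0.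
- move=> p q r s det1 J; split.
    move=> i; exists (rev_ord i); rewrite /x.
    by case: i => [[|[|//]] ?] //=; rewrite (iE_invol iso).
  pose k := omega (b e) (b (iE e)).
  have -> : J = mx_of_rows 2 [:: [:: 0; k]; [:: - k; 0]].
    apply/matrixP => i j; rewrite !mxE /x formE.
    case: i j => [[|[|//]] ?] [[|[|//]] ?] //=.
    + by rewrite (negPf ne).
    + by rewrite eqxx.
    + by rewrite (iE_invol iso) eqxx skew.
    + by rewrite (iE_invol iso) eq_sym (negPf ne).
  (* [M^T *m J *m M] is the determinant times [J] for arbitrary entries; writing 1 as the
     determinant makes the goal a polynomial identity. *)
  rewrite -[RHS]scale1r -det1.
  apply/matrixP => i j; rewrite !mxE !big_ord_recl big_ord0 !mxE.
  rewrite !big_ord_recl !big_ord0 !mxE.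
  by case: i j => [[|[|//]] ?] [[|[|//]] ?] /=; ring.
by move=> p q r s i j _ _; rewrite !sx.
Qed.

(** The plane of [e] and its dual alone carries only the solvable group O_2. The self-dual [e0] lies
    in the same class, and the resulting three-dimensional quadratic space admits SL_2. *)
Lemma borel_flag_dual_neq_sym e e0 : (forall u v, omega u v = omega v u) ->
  iE e0 = e0 -> iE e != e -> sigma e != sigma (iE e).
Proof.
move=> symm e00 ne; apply/eqP => ee'.
have se0 := isotropic_flag_fixed basis_b iso isoflag e00 ee'.
have ne0 : e != e0 by apply: contraNneq ne => ->; rewrite e00.
have ne0' : iE e != e0.
  by apply: contraNneq ne0 => iee0; rewrite -(iE_invol iso e) iee0 e00.
pose x (i : 'I_3) := nth e [:: e; e0; iE e] i.
have x_inj : injective x.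
  move=> i j /eqP; rewrite nth_uniq //= ?inE; first by move/eqP/val_inj.
  by rewrite negb_or ne0 eq_sym ne eq_sym ne0'.
have sx i : sigma (x i) = sigma e by rewrite /x; case: i => [[|[|[|//]]] ?].
pose k := omega (b e) (b (iE e)); pose q0 := omega (b e0) (b e0).
have k0 : k != 0 by exact: (form_basis_neq0 basis_b iso e).
have q00 : q0 != 0 by rewrite /q0 -{2}e00; exact: (form_basis_neq0 basis_b iso e0).
(* SL_2 preserves the discriminant [b^2 - 4ac] of [aX^2 + bXY + cY^2]. This scaling of [Y^2] makes
   it proportional to the quadratic form with [q0] on [XY] and pairing [k] between the outer
   vectors. *)
pose l := - k / (2 * q0).
have l0 : l != 0.
  by rewrite /l mulf_neq0 ?oppr_eq0 // invr_eq0 mulf_neq0 // (natK_neq0 1).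
(* [SL2] acts on quadratic forms in [X], [Y]; the basis is [X^2], [XY], [l Y^2]. *)
apply: (SL2_block_isom x_inj (rho := fun p q r s => mx_of_rows 3
  [:: [:: p ^+ 2; p * q; l * q ^+ 2];
      [:: 2 * p * r; p * s + q * r; 2 * l * q * s];
      [:: r ^+ 2 / l; r * s / l; s ^+ 2]])).
- apply/matrixP => i j; rewrite !mxE.
  by case: i j => [[|[|[|//]]] ?] [[|[|[|//]]] ?] /=; field.
- move=> /matrixP/(_ 0 1); rewrite !mxE /= mulr1 => /eqP.
  by rewrite oner_eq0.
- move=> p q r s p' q' r' s' _ _; apply/matrixP => i j.
  rewrite !mxE !big_ord_recl big_ord0 !mxE.
  by case: i j => [[|[|[|//]]] ?] [[|[|[|//]]] ?] /=; field.
- move=> p q r s det1 J; split.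
    move=> i; exists (rev_ord i); rewrite /x.
    by case: i => [[|[|[|//]]] ?] //=; rewrite (iE_invol iso).
  have -> : J = mx_of_rows 3 [:: [:: 0; 0; k]; [:: 0; q0; 0]; [:: k; 0; 0]].
    apply/matrixP => i j; rewrite !mxE /x formE.
    case: i j => [[|[|[|//]]] ?] [[|[|[|//]]] ?] //=.
    + by rewrite eq_sym (negPf ne).
    + by rewrite eq_sym (negPf ne0').
    + by rewrite eqxx.
    + by rewrite e00 (negPf ne0).
    + by rewrite e00 eqxx.
    + by rewrite e00 (negPf ne0').
    + by rewrite (iE_invol iso) eqxx symm.
    + by rewrite (iE_invol iso) eq_sym (negPf ne0).
    + by rewrite (iE_invol iso) (negPf ne).
  transitivity ((p * s - q * r) ^+ 2 *:
    mx_of_rows 3 [:: [:: 0; 0; k]; [:: 0; q0; 0]; [:: k; 0; 0]]); last first.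
    by rewrite det1 expr1n scale1r.
  apply/matrixP => i j; rewrite !mxE !big_ord_recl big_ord0 !mxE.
  rewrite !big_ord_recl !big_ord0 !mxE /l.
  have two0 := natK_neq0 1.
  by case: i j => [[|[|[|//]]] ?] [[|[|[|//]]] ?] /=; field;
    rewrite ?oppr_eq0 ?k0 ?q00 ?two0.
by move=> p q r s i j _ _; rewrite !sx.
Qed.

Lemma borel_flag_neq e e' : e != e' -> iE e != e -> iE e' != e' ->
  e' != iE e -> sigma e != sigma e'.
Proof.
move=> ne nee nee' nd; apply/eqP => ee'.
(* The two duals share a class, possibly a different one; the matrices below are block diagonal, so
   the two classes are never compared. *)
have see' := isotropic_flag_eq basis_b iso isoflag ee'.
have nd' : e != iE e' by apply: contraNneq nd => ->; rewrite (iE_invol iso).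
have nie : iE e != iE e' by rewrite (can_eq (iE_invol iso)).
pose x (i : 'I_4) := nth e [:: e; e'; iE e; iE e'] i.
have x_inj : injective x.
  move=> i j /eqP; rewrite nth_uniq //= ?inE; first by move/eqP/val_inj.
  by rewrite !negb_or ne nd nd' nie eq_sym nee eq_sym nee'.
have [eps _ epsE] := form_epsilon iso.
pose k1 := omega (b e) (b (iE e)); pose k2 := omega (b e') (b (iE e')).
have k10 : k1 != 0 by exact: (form_basis_neq0 basis_b iso e).
have k20 : k2 != 0 by exact: (form_basis_neq0 basis_b iso e').
(* [SL2] acts on [e], [e'] by the standard representation and on their duals by
   its contragredient, written in the basis dual up to the factors [k1], [k2]. *)
apply: (SL2_block_isom x_inj (rho := fun p q r s => mx_of_rows 4
  [:: [:: p; q; 0; 0];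
      [:: r; s; 0; 0];
      [:: 0; 0; s; - r * (k2 / k1)];
      [:: 0; 0; - q * (k1 / k2); p]])).
- apply/matrixP => i j; rewrite !mxE.
  by case: i j => [[|[|[|[|//]]]] ?] [[|[|[|[|//]]]] ?] //=;
    rewrite oppr0 mul0r.
- move=> /matrixP/(_ 0 1); rewrite !mxE /= => /eqP.
  by rewrite oner_eq0.
- move=> p q r s p' q' r' s' _ _; apply/matrixP => i j.
  rewrite !mxE !big_ord_recl big_ord0 !mxE.
  by case: i j => [[|[|[|[|//]]]] ?] [[|[|[|[|//]]]] ?] /=; field;
    rewrite ?k10 ?k20.
- move=> p q r s det1 J; split.
    move=> i; exists (inord ((i + 2) %% 4)); rewrite /x.
    by case: i => [[|[|[|[|//]]]] ?] //=; rewrite inordK //= (iE_invol iso).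
  have -> : J = mx_of_rows 4 [:: [:: 0; 0; k1; 0]; [:: 0; 0; 0; k2];
      [:: eps * k1; 0; 0; 0]; [:: 0; eps * k2; 0; 0]].
    apply/matrixP => i j; rewrite !mxE /x formE.
    case: i j => [[|[|[|[|//]]]] ?] [[|[|[|[|//]]]] ?] //=;
      rewrite ?(iE_invol iso) ?eqxx //.
    + by rewrite eq_sym (negPf nee).
    + by rewrite (negPf nd).
    + by rewrite eq_sym (negPf nie).
    + by rewrite (negPf nd').
    + by rewrite eq_sym (negPf nee').
    + by rewrite (negPf nie).
    + by rewrite eq_sym (negPf ne).
    + by rewrite (negPf nee).
    + by rewrite eq_sym (negPf nd').
    + by rewrite (negPf ne).
    + by rewrite eq_sym (negPf nd).
    + by rewrite (negPf nee').
  rewrite -[RHS]scale1r -det1.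
  apply/matrixP => i j; rewrite !mxE !big_ord_recl big_ord0 !mxE.
  rewrite !big_ord_recl !big_ord0 !mxE.
  by case: i j => [[|[|[|[|//]]]] ?] [[|[|[|[|//]]]] ?] /=; field;
    rewrite ?k10 ?k20.
move=> p q r s i j _; rewrite !mxE /x.
by case: i j => [[|[|[|[|//]]]] ?] [[|[|[|[|//]]]] ?] /=;
  rewrite ?eqxx ?lexx // ?ee' ?see' ?lexx.
Qed.

(** If one of two vectors in a class is self-dual and the other is not, the class is self-dual and
    contains the latter together with its dual. This reduces the mixed cases to [dual_neq]. *)
Lemma borel_flag_inj_isom : injective sigma.
Proof.
have nofix_skew e : (forall u v, omega u v = - omega v u) -> iE e != e.
  move=> skew; apply/eqP => ee; have := form_basis_neq0 basis_b iso e.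
  rewrite ee -[_ == 0](inj_eq (mulfI (natK_neq0 1))) mulr0 mulr_natl mulr2n.
  by rewrite {1}skew addNr eqxx.
have dual_neq e : iE e != e -> sigma e != sigma (iE e).
  case: (iso) => _ _ [symm|skew] [_ _ _ fixE]; last exact: borel_flag_dual_neq_skew.
  by have [e0 e00 _] := fixE symm; apply: borel_flag_dual_neq_sym e00.
move=> e e' ee'; apply/eqP; apply/negPn/negP => ne.
have see' := isotropic_flag_eq basis_b iso isoflag ee'.
have [ie|ie] := eqVneq (iE e) e.
  have [ie'|ie'] := eqVneq (iE e') e'.
    by case/eqP: ne; apply: (iE_fixed_unique iso) ie ie'.
  by have /eqP := dual_neq e' ie'; apply; rewrite -see' ie.
have [ie'|ie'] := eqVneq (iE e') e'.
  by have /eqP := dual_neq e ie; apply; rewrite see' ie'.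
have [e'E|ne'] := eqVneq e' (iE e).
  by have /eqP := dual_neq e ie; apply; rewrite -e'E.
by have /eqP := borel_flag_neq ne ie ie' ne'.
Qed.

End Isometries.

End BorelInjective.

(** * Elimination *)

Lemma seq_argmin (T : eqType) d (A : orderType d) (h : T -> A) (s : seq T) x :
  x \in s -> exists2 y, y \in s & {in s, forall z, h y <= h z}%O.
Proof.
elim: s x => // a [|a' s] IHs x _.
  by exists a; rewrite ?mem_head // => z; rewrite inE => /eqP->.
have [y ys ymin] := IHs a' (mem_head _ _).
have [ay|/ltW ya] := leP (h a) (h y).
  exists a; rewrite ?mem_head // => z; rewrite inE => /orP[/eqP->//|/ymin].
  exact: le_trans.
exists y; first by rewrite inE ys orbT.
by move=> z; rewrite inE => /orP[/eqP->//|/ymin].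
Qed.

Lemma seq_argmax (T : eqType) d (A : orderType d) (h : T -> A) (s : seq T) x :
  x \in s -> exists2 y, y \in s & {in s, forall z, h z <= h y}%O.
Proof. exact: (@seq_argmin T _ A^d). Qed.

Section DualSwap.
Variables (E : eqType) (i : E -> E) (iK : involutive i) (f f' : E).
Hypothesis fixed_iff : i f = f <-> i f' = f'.

(* For [i = id] this is the transposition of [f] and [f']. *)
Definition dual_swap_fun e :=
  if e == f then f' else if e == f' then f else
  if e == i f then i f' else if e == i f' then i f else e.

Lemma dual_swap_funK : involutive dual_swap_fun.
Proof.
move: fixed_iff => [ff' f'f] e; have := iK f; have := iK f'.
rewrite /dual_swap_fun.
case: (e =P f) => ?; case: (e =P f') => ?; case: (e =P i f) => ?;
  case: (e =P i f') => ?; rewrite /=;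
  by repeat case: eqP => ?; try congruence; intuition congruence.
Qed.

Definition dual_swap : sym E := Sym dual_swap_funK dual_swap_funK.

Lemma dual_swapl : dual_swap f = f'.
Proof. by rewrite /= /dual_swap_fun eqxx. Qed.

Lemma dual_swap_out e :
  e != f -> e != f' -> e != i f -> e != i f' -> dual_swap e = e.
Proof. by move=> /= /negPf ef /negPf ef' /negPf eif /negPf eif';
  rewrite /dual_swap_fun ef ef' eif eif'. Qed.

Lemma dual_swap_comm e : i f <> f -> dual_swap (i e) = i (dual_swap e).
Proof.
move: fixed_iff => [_ f'f] ff; have ff' : i f' <> f' by move/f'f.
rewrite /= /dual_swap_fun.
have := iK f; have := iK f'; have := iK e.
case: (e =P f) => ?; case: (e =P f') => ?; case: (e =P i f) => ?;
  case: (e =P i f') => ?; rewrite /=;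
  by repeat case: eqP => ?; congruence.
Qed.

Lemma dual_swapK e : dual_swap (dual_swap e) = e.
Proof. exact: dual_swap_funK. Qed.

End DualSwap.

(** * The invariant of the elimination *)

Section Existence.
Variables (K : closedFieldType) (V : lmodType K) (E : countType) (b : E -> V).
Hypothesis basis_b : is_basis b.
Local Notation co := (co basis_b).
Variables (F : nat -> {fset E}) (G : ind_group V E).
Hypothesis filtF : is_filtration F.
Hypothesis admG : admissible b F G.

Definition dual_closed (X : {fset E}) : Prop :=
  if G is Isom _ iE then forall e, e \in X -> iE e \in X else True.

(** [X] holds the source vectors still to be treated. On [X] the bijection [w] carries no
    information about single images; it only records which targets remain. *)
Record monomial_outside (X : {fset E}) (w : sym E) (g : sym V) : Prop := {
  mo_ind : ind_set b G g;
  mo_weyl : weyl G w;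
  mo_dual : dual_closed X;
  mo_out : forall e, e \notin X -> exists2 c, c != 0 & g (b e) = c *: b (w e);
  mo_in : forall e e', e \in X -> co (g (b e)) e' != 0 -> w^-1%g e' \in X }.

Lemma weyl_dual_swap (w : sym E) (i : E -> E) (iK : involutive i) f f'
    (ff' : i f = f <-> i f' = f') :
  (if G is Isom _ iE then i = iE /\ i f <> f else True) ->
  weyl G w -> weyl G (w * dual_swap iK ff')%g.
Proof.
move=> iG [wfin wG]; split.
  apply: (@sub_finite_set _ _
    ([set e | w e <> e] `|` [set` [fset f; f'; i f; i f']%fset])).
    move=> e /= we; apply: contrapT => /not_orP[/contrapT we0].
    rewrite !inE => /negP; rewrite !negb_or => /andP[/andP[/andP[ef ef'] eif] eif'].
    by apply: we; rewrite -[X in _ = X]we0 -[X in _ = w X](dual_swap_out iK ff').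
  by rewrite finite_setU; split=> //; apply: finite_fset.
case: G iG wG => //= om iE [<- iff] wG e.
by have := dual_swap_comm iK ff' e iff; rewrite /= => ->; rewrite wG.
Qed.

(** For [e] outside [X], row [w e] of [g] has its only nonzero entry in column [e]: the other
    columns outside [X] are monomial, and those in [X] have their support in [w] of [X]. *)
Lemma mo_co X w g v e : monomial_outside X w g -> e \notin X ->
  co v e != 0 -> co (g v) (w e) != 0.
Proof.
move=> mo eX; have [c c0 ge] := mo_out mo eX.
suff -> : co (g v) (w e) = c * co v e by move=> v0; rewrite mulf_neq0.
move: v; apply: (scalar_ext basis_b) => [||i].
- exact: (scalar_comp (co_scalar basis_b _) (ind_set_linear (mo_ind mo))).
- by move=> a u v; rewrite coD coZ mulrDr mulrCA.
have [->|ne] := eqVneq i e; first by rewrite ge coZ !co_basis !eqxx.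
rewrite [co (b i) e]co_basis eq_sym (negPf ne) mulr0.
have [iX|iX] := boolP (i \in X).
  apply: contraNeq eX => /(mo_in mo iX).
  by rewrite /= (sym_funK w).
have [c' c'0 ->] := mo_out mo iX.
by rewrite coZ co_basis (can_eq (sym_funK w)) eq_sym (negPf ne) mulr0.
Qed.

Lemma mo_preimage X w g e : monomial_outside X w g -> w^-1%g e \in X ->
  forall e', co (g^-1%g (b e)) e' != 0 -> e' \in X.
Proof.
move=> mo eX e'; apply: contraR => e'X; apply/eqP.
apply: contraTeq isT => /(mo_co mo e'X); rewrite sym_invE' co_basis.
case: (eqVneq (w e') e) => [we'|]; last by rewrite eqxx.
by rewrite -we' /= (sym_funK w) (negPf e'X) in eX.
Qed.

Lemma ind_set_monomial_outside g : ind_set b G g ->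
  exists X, monomial_outside X 1%g g.
Proof.
move=> Gg; have [_ /finite_fsetP[X0 X0E] _] := Gg.
pose s := flatten [seq (supp basis_b (g (b e)) : seq E) | e <- X0].
(* A level of the filtration is taken because it is stable under [iE]; it has to contain the
   supports of the images of moved vectors as well, for [mo_in]. *)
have [n sn] := filtration_seq filtF ((X0 : seq E) ++ s).
have out e : e \notin F n -> g (b e) = b e.
  move=> eF; apply: contrapT => ne; have : [set` X0] e by rewrite -X0E.
  by move=> /= eX0; rewrite sn // mem_cat eX0 in eF.
exists (F n); split=> //.
- by split; [rewrite [X in finite_set X](_ : _ = set0) //; apply/seteqP; split
    | case: G].
- by rewrite /dual_closed; case: G admG => //= om iE [_ _ _ [_ _ FE _]]; apply: FE.
- by move=> e /out ge; exists 1; rewrite ?oner_eq0 // scale1r.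
move=> e e' eF ge; rewrite invg1 /=.
have [gbe|gbe] := pselect (g (b e) = b e).
  move: ge; rewrite gbe co_basis.
  by case: (eqVneq e' e) => [->|]; rewrite ?eqxx.
have eX0 : [set` X0] e by rewrite -X0E.
apply: sn; rewrite mem_cat; apply/orP; right; apply/flattenP.
exists (supp basis_b (g (b e)) : seq E); first exact: map_f.
exact: mem_supp.
Qed.

(** At most the self-dual vector is left in [X]. Then [mo_in] confines its image to a line, and
    invertibility makes the coefficient nonzero. *)
Lemma mo_terminal X w g : monomial_outside X w g ->
  (forall e, e \in X -> if G is Isom _ iE then iE e = e else False) ->
  monomial b w g.
Proof.
move=> mo fixX e; have [eX|] := boolP (e \in X); last exact: mo_out.
have gb0 : g (b e) <> 0.
  move=> ge0; apply: (basis_neq0 basis_b (e := e)).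
  rewrite -[LHS](sym_invE g) ge0.
  exact: linear_fun0 (linear_sym_inv (ind_set_linear (mo_ind mo))).
have gbE : g (b e) = co (g (b e)) (w e) *: b (w e).
  apply: (@co_ext _ _ _ _ basis_b) => e'; rewrite coZ co_basis.
  case: (eqVneq e' (w e)) => [->|ne]; first by rewrite mulr1.
  rewrite mulr0; apply: contraNeq ne => /(mo_in mo eX) e'X.
  have := fixX _ e'X; have := fixX _ eX.
  case: G admG => //= om iE iso ie ie'.
  by rewrite (iE_fixed_unique iso ie ie') (sym_invK w).
exists (co (g (b e)) (w e)) => //; apply: contra_notN gb0 => /eqP ge0.
by rewrite gbE ge0 scale0r.
Qed.

End Existence.

(** * Transvections and the elimination step in the general linear case *)

Section Transvections.
Variables (K : closedFieldType) (V : lmodType K) (E : countType) (b : E -> V).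
Hypothesis basis_b : is_basis b.
Local Notation co := (co basis_b).
Variables (phi : V -> K) (z : V).
Hypotheses (phi_scalar : scalar phi) (phi_z : phi z = 0).

Let transvK : cancel (fun v => v + phi v *: z) (fun v => v - phi v *: z).
Proof.
by move=> v; rewrite scalar_funD // scalar_funZ // phi_z mulr0 addr0 addrK.
Qed.

Let transvVK : cancel (fun v => v - phi v *: z) (fun v => v + phi v *: z).
Proof.
by move=> v; rewrite scalar_funB // scalar_funZ // phi_z mulr0 subr0 subrK.
Qed.

Definition transvection : sym V := Sym transvK transvVK.

Lemma transvection_stabilizer d (A : orderType d) (sigma : E -> A) :
  finite_set [set e | phi (b e) <> 0] ->
  (forall e e', phi (b e) != 0 -> co z e' != 0 -> (sigma e' <= sigma e)%O) ->
  flag_stabilizer b GenLin sigma transvection.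
Proof.
move=> fin tri; apply/(flag_stabilizerP basis_b).
  split=> //.
    by move=> c u v /=; rewrite phi_scalar scalerDr scalerDl scalerA addrACA.
  apply: sub_finite_set fin => e ne phi0; apply: ne.
  by rewrite /= phi0 scale0r addr0.
have tri_aux c e e' : co (b e + (c * phi (b e)) *: z) e' != 0 ->
    (sigma e' <= sigma e)%O.
  rewrite coD coZ co_basis.
  case: (eqVneq e' e) => [->//|ne]; rewrite add0r !mulf_eq0 !negb_or.
  by move=> /andP[/andP[_ phi0] ze']; apply: tri.
split=> e e'; first by rewrite /= -[phi _]mul1r; apply: tri_aux.
by rewrite /= -scaleNr -mulN1r; apply: tri_aux.
Qed.

End Transvections.

Section GeneralLinear.
Variables (K : closedFieldType) (V : lmodType K) (E : countType) (b : E -> V).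
Hypothesis basis_b : is_basis b.
Local Notation co := (co basis_b).
Variables (dP dB : Order.disp_t) (AP : orderType dP) (AB : orderType dB).
Variables (sigmaP : E -> AP) (sigmaB : E -> AB).

Lemma elimination_step_gen X (w : sym E) g : X != fset0 ->
  monomial_outside basis_b GenLin X w g ->
  exists beta p X' w', [/\ flag_stabilizer b GenLin sigmaB beta,
    flag_stabilizer b GenLin sigmaP p, (#|` X'| < #|` X|)%N &
    monomial_outside basis_b GenLin X' w' (beta * g * p)%g].
Proof.
move=> /fset0Pn[y0 y0X] mo; have gl := ind_set_linear (mo_ind mo).
have gVl := linear_sym_inv gl.
have [f' f'X f'min] := seq_argmin (fun y => sigmaB (w y)) y0X.
pose e1 := w f'; have we1 : w^-1%g e1 = f' by rewrite /e1 /= (sym_funK w).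
pose x := g^-1%g (b e1).
have xX e : co x e != 0 -> e \in X.
  by apply: (mo_preimage mo); rewrite we1.
have [f fx fmax] : exists2 f, co x f != 0 &
    forall e, co x e != 0 -> (sigmaP e <= sigmaP f)%O.
  pose s := [seq e <- supp basis_b x | co x e != 0].
  have sE e : (e \in s) = (co x e != 0).
    rewrite mem_filter; case: (boolP (co x e != 0)) => //= xe.
    exact: mem_supp.
  have [e xe] : exists e, co x e != 0.
    apply: contrapT => nex; apply: (basis_neq0 basis_b (e := e1)).
    rewrite -[LHS](sym_invE' g) -/x.
    suff -> : x = 0 by apply: linear_fun0.
    apply: (@co_ext _ _ _ _ basis_b) => e; rewrite co0; apply/eqP.
    by apply/negPn/negP => xe; apply: nex; exists e.
  rewrite -sE in xe; have [f fs fmax] := seq_argmax sigmaP xe.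
  by exists f => [|i]; rewrite -sE // => /fmax.
set c := co x f in fx *; have fX := xX _ fx.
(* The transvection along this vector sends [b f] to [c^-1 *: x], hence [g * T] sends [b f] to a
   multiple of [b e1]. Maximality of [f] in the support of [x] puts it in the stabilizer for
   [sigmaP]. *)
have zf : co (c^-1 *: x - b f) f = 0.
  by rewrite coB coZ co_basis eqxx -/c mulVf // subrr.
pose T := transvection (co_scalar basis_b f) zf.
have TE v : T v = v + co v f *: (c^-1 *: x - b f) by [].
have PT : flag_stabilizer b GenLin sigmaP T.
  apply: transvection_stabilizer.
    apply: (@sub_finite_set _ _ [set` [fset f]%fset]) => // e /= ne.
    rewrite in_fset1; apply: contra_notT ne => ne.
    by rewrite co_basis eq_sym (negPf ne).
  move=> e e'; rewrite co_basis; case: (eqVneq f e) => [<- _|]; last by rewrite eqxx.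
  rewrite coB coZ co_basis.
  case: (eqVneq e' f) => [->//|ne]; rewrite subr0 mulf_eq0 negb_or.
  by move=> /andP[_ /fmax].
have Tf : T (b f) = c^-1 *: x.
  by rewrite TE co_basis eqxx scale1r addrC subrK.
have Tout e : e != f -> T (b e) = b e.
  by move=> ne; rewrite TE co_basis eq_sym (negPf ne) scale0r addr0.
have gTl : linear (g * T)%g by apply: linear_comp gl _; case: PT => [[]].
(* Adding [psi] times [b e1] makes the [e1]-th coordinate of the image of any [v] under
   [gam * g * T] equal to [c^-1 * co v f]: row [e1] is cleared outside column [f]. *)
pose psi v := c^-1 * co ((g * T)^-1%g v) f - co v e1.
have psi_scalar : scalar psi.
  move=> a u v; rewrite /psi (linear_sym_inv gTl).
  move: ((g * T)^-1%g u) ((g * T)^-1%g v) => u1 v1; rewrite !coD !coZ.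
  by ring.
have gTf : (g * T)%g (b f) = c^-1 *: b e1.
  by rewrite sym_mulE Tf linear_funZ // /x sym_invE'.
have psi_e1 : psi (b e1) = 0.
  have -> : b e1 = (g * T)%g (c *: b f).
    by rewrite (linear_funZ _ _ gTl) gTf scalerA mulfV // scale1r.
  rewrite /psi sym_invE (linear_funZ _ _ gTl) gTf scalerA mulfV // scale1r.
  by rewrite coZ !co_basis !eqxx mulr1 mulVf // subrr.
pose gam := transvection psi_scalar psi_e1.
have gamE v : gam v = v + psi v *: b e1 by [].
have psi_out e : e \notin X -> psi (b (w e)) = 0.
  move=> eX; have ef : e != f by apply: contraNneq eX => ->.
  have [a a0 ge] := mo_out mo eX.
  have -> : b (w e) = (g * T)%g (a^-1 *: b e).
    by rewrite (linear_funZ _ _ gTl) sym_mulE Tout // ge scalerA mulVf // scale1r.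
  rewrite /psi sym_invE (linear_funZ _ _ gTl) sym_mulE Tout // ge.
  rewrite scalerA mulVf // scale1r coZ !co_basis.
  rewrite [f == e]eq_sym (negPf ef) !mulr0 sub0r /e1 (can_eq (sym_funK w)).
  by case: (eqVneq f' e) => [f'e|]; [rewrite -f'e f'X in eX | rewrite oppr0].
have psiX e : psi (b e) <> 0 -> w^-1%g e \in X.
  move=> psi0; apply: contra_notT psi0 => /psi_out.
  by rewrite /= (sym_invK w).
have Bgam : flag_stabilizer b GenLin sigmaB gam.
  apply: transvection_stabilizer.
    apply: (@sub_finite_set _ _ [set` [fset w e | e in X]%fset]) => // e /psiX eX.
    apply/imfsetP; exists (w^-1%g e) => //=.
    by rewrite (sym_invK w).
  move=> e e' /eqP/psiX eX; rewrite co_basis.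
  case: (eqVneq e' e1) => [-> _|]; last by rewrite eqxx.
  by have := f'min _ eX; rewrite /= (sym_invK w).
have ff' : id f = f <-> id f' = f' by [].
(* The target [e1] now belongs to [f], whereas [w] assigns it to [f']. *)
pose s := dual_swap (fun=> erefl) ff'.
have s_in e : e \in X -> s e \in X.
  by rewrite /= /dual_swap_fun; do 4! [case: eqP => // _].
exists gam, T, (X `\ f)%fset, (w * s)%g; split=> //.
  by rewrite [X in (_ < X)%N](cardfsD1 f) fX.
have Gw := mo_weyl mo.
split=> //.
- apply: ind_setM; last by case: PT.
  by apply: ind_setM; [case: Bgam | exact: mo_ind mo].
- exact: weyl_dual_swap.
- move=> e; rewrite in_fsetD1 negb_and negbK => /orP[/eqP->|eX].
    exists c^-1; first by rewrite invr_eq0.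
    rewrite -mulgA [LHS]sym_mulE gTf gamE (scalar_funZ _ _ psi_scalar) psi_e1 mulr0.
    by rewrite scale0r addr0 sym_mulE /s dual_swapl.
  have ef : e != f by apply: contraNneq eX => ->.
  have ef' : e != f' by apply: contraNneq eX => ->.
  have [a a0 ge] := mo_out mo eX; exists a => //.
  rewrite -mulgA [LHS]sym_mulE [(g * T)%g _]sym_mulE Tout // ge gamE (scalar_funZ _ _ psi_scalar).
  by rewrite psi_out // mulr0 scale0r addr0 sym_mulE /s dual_swap_out.
move=> e e'; rewrite !in_fsetD1 => /andP[ef eX].
rewrite -mulgA sym_mulE gamE coD coZ co_basis.
have [->|e'e1] := eqVneq e' e1.
  rewrite mulr1 /psi sym_invE co_basis [f == e]eq_sym (negPf ef) mulr0 sub0r.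
  by rewrite subrr eqxx.
rewrite mulr0 addr0 sym_mulE Tout // => /(mo_in mo eX) we'X.
have -> : (w * s)^-1%g e' = s (w^-1%g e') by [].
rewrite s_in // andbT; apply: contra_neq e'e1 => swf.
by rewrite -(sym_invK w e') -[sym_inv w e'](dual_swapK (fun=> erefl) ff') -/s swf
  /s dual_swapl.
Qed.

End GeneralLinear.

(** * Eichler transformations *)

Section Eichler.
Variables (K : closedFieldType) (V : lmodType K) (E : countType) (b : E -> V).
Hypothesis basis_b : is_basis b.
Local Notation co := (co basis_b).
Variables (F : nat -> {fset E}) (omega : V -> V -> K) (iE : E -> E).
Hypothesis iso : isotropic_form b F omega iE.
Variables (eps : K) (f : E).
Hypotheses (eps2 : eps * eps = 1) (epsE : forall u v, omega u v = eps * omega v u).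
Hypothesis f_dual : iE f != f.

Let b' := b (iE f).
Let k := omega (b f) b'.

Let k_neq0 : k != 0. Proof. exact: (form_basis_neq0 basis_b iso). Qed.

Let omD u v w : omega (u + v) w = omega u w + omega v w.
Proof. exact: scalar_funD (form_scalarl iso w). Qed.

Let omZ a u w : omega (a *: u) w = a * omega u w.
Proof. exact: scalar_funZ (form_scalarl iso w). Qed.

Let omDr u v w : omega w (u + v) = omega w u + omega w v.
Proof. exact: scalar_funD (form_scalarr iso w). Qed.

Let omZr a u w : omega w (a *: u) = a * omega w u.
Proof. exact: scalar_funZ (form_scalarr iso w). Qed.

Let om_b'b' : omega b' b' = 0.
Proof.
by apply: (form_basis0 iso); rewrite (iE_invol iso); apply/eqP.
Qed.

Let om_ff : omega (b f) (b f) = 0.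
Proof. by apply: (form_basis0 iso); apply/eqP; rewrite eq_sym. Qed.

Let om_b'f : omega b' (b f) = eps * k. Proof. exact: epsE. Qed.

(* Sends [b f] to [b f + u + a *: b'] and fixes [b']; for an [eichler_datum] it
   is the isometry with these properties that moves the vectors orthogonal to
   [b f] and [b'] only by multiples of [b']. *)
Definition eichler_fun u a v : V :=
  v + ((omega v b' / k) *: (u + a *: b') + - (omega u v / k) *: b').

(** Given the first two conditions, the last one says that [b f + u + a *: b'] is isotropic, as the
    image of [b f] under an isometry must be. *)
Definition eichler_datum u a :=
  [/\ co u f = 0, co u (iE f) = 0 & (1 + eps) * a * k + omega u u = 0].

Let datum_orth u a : eichler_datum u a -> omega u b' = 0 /\ omega b' u = 0.
Proof.
move=> [uf _ _]; have ub' : omega u b' = 0.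
  by rewrite (form_basisl basis_b iso) (iE_invol iso) uf mul0r.
by split=> //; rewrite epsE ub' mulr0.
Qed.

Let datum_orth_f u a : eichler_datum u a -> omega u (b f) = 0.
Proof. by move=> [_ uf _]; rewrite (form_basisl basis_b iso) uf mul0r. Qed.

(** These are the parameters of the inverse. For a symmetric form [a] is tied to the square of [u],
    which is even in [u]; for a skew form [a] is free and changes sign. *)
Lemma eichler_datumN u a : eichler_datum u a -> eichler_datum (- u) (eps * a).
Proof.
move=> [uf uf' ua]; rewrite -scaleN1r; split; rewrite ?coZ ?uf ?uf' ?mulr0 //.
have -> : (1 + eps) * (eps * a) * k = (eps + eps * eps) * a * k by ring.
by rewrite omZ omZr mulrA mulrNN !mul1r eps2 [eps + 1]addrC.
Qed.

Lemma eichlerK u a : eichler_datum u a ->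
  cancel (eichler_fun u a) (eichler_fun (- u) (eps * a)).
Proof.
move=> ua; have [ub' b'u] := datum_orth ua; have [_ _ ua0] := ua.
move=> v; rewrite /eichler_fun -(scaleN1r u).
rewrite !(omD, omDr, omZ, omZr) ub' om_b'b'.
have -> : omega u u = - ((1 + eps) * a * k).
  by rewrite -[RHS]addr0 -ua0 addKr.
by apply: (@co_ext _ _ _ _ basis_b) => e; rewrite !(coD, coZ); field.
Qed.

Lemma eichler_preserves u a v w : eichler_datum u a ->
  omega (eichler_fun u a v) (eichler_fun u a w) = omega v w.
Proof.
move=> ua; have [ub' b'u] := datum_orth ua; have [_ _ ua0] := ua.
rewrite /eichler_fun !(omD, omDr, omZ, omZr) ub' b'u om_b'b'.
have -> : omega u u = - ((1 + eps) * a * k).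
  by rewrite -[RHS]addr0 -ua0 addKr.
rewrite [omega v u]epsE [omega b' w]epsE.
by field.
Qed.

Lemma eichler_linear u a : linear (eichler_fun u a).
Proof.
move=> c v w; rewrite /eichler_fun !(omD, omDr, omZ, omZr).
by apply: (@co_ext _ _ _ _ basis_b) => e; rewrite !(coD, coZ); field.
Qed.

(** A basis vector [e] other than [f] only gains a multiple of [b'], and only if [iE e] occurs in
    [u]; then [iE e] is at most [f], and duality puts [iE f] below [e]. *)
Lemma eichler_triangular d (A : orderType d) (sigma : E -> A) u a :
  isotropic_flag b (Isom omega iE) sigma ->
  (forall e, co u e != 0 -> (sigma e <= sigma f)%O) ->
  (a != 0 -> (sigma (iE f) <= sigma f)%O) ->
  triangular basis_b sigma (eichler_fun u a).
Proof.
move=> isoflag uf af e e'; have [->//|ne] := eqVneq e' e.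
rewrite /eichler_fun !(coD, coZ) !co_basis (negPf ne) add0r => nz.
have [t0|t0] := eqVneq (omega (b e) b') 0.
  rewrite t0 mul0r mul0r add0r in nz.
  move: nz; rewrite mulf_eq0 negb_or.
  case: (eqVneq e' (iE f)) => [->|]; last by rewrite eqxx andbF.
  rewrite (form_basisl basis_b iso) oppr_eq0 !mulf_eq0 !negb_or.
  move=> /andP[/andP[/andP[/uf]]] /(isotropic_flag_le basis_b iso isoflag).
  by rewrite (iE_invol iso).
have ef : e = f.
  apply: contra_neq_eq t0 => ef; apply: (form_basis0 iso).
  by move=> /(can_inj (iE_invol iso)) fe; rewrite fe eqxx in ef.
rewrite ef in ne nz *; have [/uf//|u0] := boolP (co u e' != 0).
rewrite negbK in u0.
have [e'f|e'f] := eqVneq e' (iE f); last first.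
  by rewrite (eqP u0) (negPf e'f) !mulr0 !addr0 mulr0 eqxx in nz.
rewrite e'f; apply: af; apply: contraNneq nz => ->.
rewrite (eqP u0) (form_basisl basis_b iso) -e'f (eqP u0).
by rewrite !mul0r oppr0 mul0r !addr0 mulr0.
Qed.

Lemma eichler_datum_of x : co x f = 1 -> omega x x = 0 ->
  eichler_datum (x - b f - co x (iE f) *: b') (co x (iE f)).
Proof.
move=> xf xx; set a := co x (iE f); set u := x - _ - _.
have uf : co u f = 0.
  rewrite /u !coB coZ !co_basis xf eqxx subrr.
  by rewrite [f == _]eq_sym (negPf f_dual) mulr0 subr0.
have uf' : co u (iE f) = 0.
  by rewrite /u !coB coZ !co_basis eqxx (negPf f_dual) subr0 mulr1 subrr.
split=> //.
have uf0 : omega u (b f) = 0 by rewrite (form_basisl basis_b iso) uf' mul0r.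
have ub' : omega u b' = 0.
  by rewrite (form_basisl basis_b iso) (iE_invol iso) uf mul0r.
have xE : x = b f + u + a *: b' by rewrite /u addrA subrK addrC subrK.
clearbody u a; rewrite -[RHS]xx [in RHS]xE !(omD, omDr, omZ, omZr) om_ff om_b'f om_b'b' uf0 ub'.
rewrite [omega (b f) u]epsE [omega b' u]epsE uf0 ub' -/k.
by ring.
Qed.

(** Used twice in each elimination step: at the pivot with the flag of P, and at the dual of the
    target with the flag of B. *)
Lemma eichler_exists x : co x f = 1 -> omega x x = 0 ->
  exists T : sym V, [/\ T (b f) = x, T (b (iE f)) = b (iE f),
    forall e, e != f -> co x (iE e) = 0 -> T (b e) = b e &
    forall d (A : orderType d) (sigma : E -> A),
      isotropic_flag b (Isom omega iE) sigma ->
      (forall e, co x e != 0 -> (sigma e <= sigma f)%O) ->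
      flag_stabilizer b (Isom omega iE) sigma T].
Proof.
move=> xf xx; have ua := eichler_datum_of xf xx.
set a := co x (iE f) in ua *; set u := x - _ - _ in ua.
have uaN := eichler_datumN ua.
have VK : cancel (eichler_fun (- u) (eps * a)) (eichler_fun u a).
  by have := eichlerK uaN; rewrite opprK mulrA eps2 mul1r.
have u_f : omega u (b f) = 0 by apply: datum_orth_f ua.
have [ub' _] := datum_orth ua.
have fixed e : e != f -> co u (iE e) = 0 -> eichler_fun u a (b e) = b e.
  move=> ef ue; rewrite /eichler_fun (form_basisl basis_b iso u) ue.
  have -> : omega (b e) b' = 0.
    apply: (form_basis0 iso) => /(can_inj (iE_invol iso)) fe.
    by rewrite fe eqxx in ef.
  by rewrite !(mul0r, oppr0, scale0r, addr0).
have u_x e : co u e != 0 -> co x e != 0.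
  have [-> |ef] := eqVneq e f; first by case: ua => ->; rewrite eqxx.
  have [->|ef'] := eqVneq e (iE f); first by case: ua => _ ->; rewrite eqxx.
  by rewrite /u !coB coZ !co_basis (negPf ef) (negPf ef') mulr0 !subr0.
exists (Sym (eichlerK ua) VK); split=> /=.
- rewrite /eichler_fun u_f !(mul0r, oppr0, scale0r, addr0) mulfV // scale1r.
  by rewrite /u subrK addrC subrK.
- by rewrite /eichler_fun om_b'b' ub' !(mul0r, oppr0, scale0r, addr0).
- move=> e ef xe; apply: fixed => //; apply/eqP.
  by apply: contraTT isT => /u_x; rewrite xe eqxx.
move=> d A sigma isoflag xsigma; apply/(flag_stabilizerP basis_b).
  split; [exact: eichler_linear | | by move=> v w _ _; apply: eichler_preserves].
  apply: (@sub_finite_set _ _ [set` (f |` [fset iE e | e in supp basis_b u])%fset]) => //.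
  move=> e /=; rewrite !inE; case: (eqVneq e f) => //= ef ne.
  apply/imfsetP; exists (iE e); rewrite /= ?(iE_invol iso) //.
  by apply: mem_supp; apply: contra_notN ne => /eqP; apply: fixed.
split.
  by apply: eichler_triangular => // [e /u_x/xsigma|/xsigma].
apply: eichler_triangular => // [e|].
  by rewrite -scaleN1r coZ mulf_eq0 negb_or => /andP[_ /u_x/xsigma].
by rewrite mulf_eq0 negb_or => /andP[_ /xsigma].
Qed.

End Eichler.

(** * The elimination step for isometries *)

Section IsometryElimination.
Variables (K : closedFieldType) (V : lmodType K) (E : countType) (b : E -> V).
Hypothesis basis_b : is_basis b.
Local Notation co := (co basis_b).
Variables (F : nat -> {fset E}) (omega : V -> V -> K) (iE : E -> E).
Hypothesis iso : isotropic_form b F omega iE.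
Local Notation G := (Isom omega iE).

Let iK := iE_invol iso.

(** For isometries [mo_in] is automatic: [X] is self-dual, so the images of its vectors are
    orthogonal to those of the vectors outside [X], which are multiples of basis vectors. *)
Lemma mo_isom X (w : sym E) g :
  ind_set b G g -> weyl G w -> dual_closed G X ->
  (forall e, e \notin X -> exists2 c, c != 0 & g (b e) = c *: b (w e)) ->
  monomial_outside basis_b G X w g.
Proof.
move=> Gg Gw Xi out; split=> // e e' eX; apply: contraR => e'X.
have [[_ _ gG] [_ wi]] := (Gg, Gw).
have ie'X : iE (w^-1%g e') \notin X.
  by apply: contra e'X => /Xi; rewrite iK.
have [c c0 ge'] := out _ ie'X.
have /esym := gG (b e) (b (iE (w^-1%g e'))) I I.
rewrite ge' wi (sym_invE' w) (form_basis0 iso) => [|/(can_inj iK) we'].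
  rewrite (scalar_funZ _ _ (form_scalarr iso _)) => /esym/eqP.
  rewrite (form_basisl basis_b iso) iK !mulf_eq0 (negPf c0) /=.
  by rewrite (negPf (form_basis_neq0 basis_b iso e')) orbF.
by rewrite we' eX in e'X.
Qed.

(* A self-dual vector cannot be the only largest one in the support of an
   isotropic [x]: its square would be the only term left in [omega x x]. *)
Lemma isotropic_pivot d (A : orderType d) (sigma : E -> A) x :
  isotropic_flag b G sigma -> x <> 0 -> omega x x = 0 ->
  exists f, [/\ iE f != f, co x f != 0 &
    forall e, co x e != 0 -> (sigma e <= sigma f)%O].
Proof.
move=> isoflag x0 xx.
pose s := [seq e <- supp basis_b x | co x e != 0].
have sE e : (e \in s) = (co x e != 0).
  rewrite mem_filter; case: (boolP (co x e != 0)) => //= xe.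
  exact: mem_supp.
have [e xe] : exists e, co x e != 0.
  apply: contrapT => nex; apply: x0.
  apply: (@co_ext _ _ _ _ basis_b) => e; rewrite co0; apply/eqP.
  by apply/negPn/negP => xe; apply: nex; exists e.
rewrite -sE in xe; have [f fs fmax] := seq_argmax sigma xe.
rewrite sE in fs; have {}fmax i : co x i != 0 -> (sigma i <= sigma f)%O.
  by rewrite -sE => /fmax.
have [ff|ff] := eqVneq (iE f) f; last by exists f.
have [[f' [xf' sf' ff']]|nof'] :=
  pselect (exists f', [/\ co x f' != 0, sigma f' = sigma f & f' != f]).
  exists f'; split=> // [|i]; last by rewrite sf'; apply: fmax.
  by apply: contra_neq ff' => ff'; apply: (iE_fixed_unique iso).
have lt i : co x i != 0 -> i != f -> (sigma i < sigma f)%O.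
  move=> xi nif; rewrite lt_neqAle fmax // andbT.
  by apply/eqP => si; apply: nof'; exists i.
suff /eqP : omega x x != 0 by rewrite xx.
rewrite {1}(coE basis_b x) (scalar_fun_sum _ _ (form_scalarl iso x)).
rewrite (big_fsetD1 f) ?mem_supp //= big1_seq ?addr0.
  rewrite (scalar_funZ _ _ (form_scalarl iso x)) (form_basisr basis_b iso) !mulf_neq0 //.
    by rewrite ff.
  exact: (form_basis_neq0 basis_b iso).
move=> i /andP[_]; rewrite in_fsetD1 => /andP[nif _].
rewrite (scalar_funZ _ _ (form_scalarl iso x)) (form_basisr basis_b iso).
have [->|xi] := eqVneq (co x i) 0; first by rewrite mul0r.
have [->|xii] := eqVneq (co x (iE i)) 0; first by rewrite mul0r mulr0.
(* As [i] lies strictly below the self-dual [f], its dual lies strictly above [f] and cannot occur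
   in [x]. *)
have := isotropic_flag_lt basis_b iso isoflag (lt i xi nif).
by rewrite ff ltNge fmax.
Qed.

Variables (dP dB : Order.disp_t) (AP : orderType dP) (AB : orderType dB).
Variables (sigmaP : E -> AP) (sigmaB : E -> AB).
Hypotheses (isoflagP : isotropic_flag b G sigmaP).
Hypotheses (isoflagB : isotropic_flag b G sigmaB) (sigmaB_inj : injective sigmaB).

Lemma elimination_step_isom X (w : sym E) g y0 : y0 \in X -> iE y0 != y0 ->
  monomial_outside basis_b G X w g ->
  exists beta p X' w', [/\ flag_stabilizer b G sigmaB beta^-1%g,
    flag_stabilizer b G sigmaP p, (#|` X'| < #|` X|)%N &
    monomial_outside basis_b G X' w' (beta * g * p)%g].
Proof.
move=> y0X y00 mo; have Gg := mo_ind mo; have gl := ind_set_linear Gg.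
have gVl := linear_sym_inv gl.
have Gw := mo_weyl mo; have wi : forall e, w (iE e) = iE (w e) by case: Gw.
have Xi := mo_dual mo.
have [eps eps1 epsE] := form_epsilon iso.
have eps2 : eps * eps = 1 by case: eps1 => ->; rewrite ?mulrNN mulr1.
have [f' f'X f'min] := seq_argmin (fun y => sigmaB (w y)) y0X.
(* If [f'] were self-dual, duality would bound [w y0] and [w (iE y0)] by [w f'] from above as well
   as from below, making [y0] self-dual. *)
have f'0 : iE f' != f'.
  apply: contra_neq y00 => f'0; rewrite -[RHS]iK; congr (iE _).
  apply: (can_inj (sym_funK w)); apply: sigmaB_inj; apply/eqP; rewrite eq_le.
  have ley := f'min _ y0X; have leiy := f'min _ (Xi _ y0X).
  have := isotropic_flag_le basis_b iso isoflagB ley.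
  rewrite -!wi f'0 => le1.
  have := isotropic_flag_le basis_b iso isoflagB leiy.
  rewrite -!wi f'0 iK => le2.
  by rewrite (le_trans le2 leiy) (le_trans le1 ley).
pose e1 := w f'; have we1 : w^-1%g e1 = f' by rewrite /e1 /= (sym_funK w).
have e10 : iE e1 != e1 by rewrite /e1 -wi (can_eq (sym_funK w)).
pose x0 := g^-1%g (b e1).
have x0X e : co x0 e != 0 -> e \in X.
  by apply: (mo_preimage mo); rewrite we1.
have om_e1 e : iE e != e -> omega (b e) (b e) = 0.
  by move=> ee; apply: (form_basis0 iso); apply/eqP; rewrite eq_sym.
have gG u v : omega (g u) (g v) = omega u v by case: Gg => _ _; apply.
have x0x0 : omega x0 x0 = 0 by rewrite -gG /x0 !sym_invE' om_e1.
have x0_neq0 : x0 <> 0.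
  move=> x00; apply: (basis_neq0 basis_b (e := e1)).
  by rewrite -[LHS](sym_invE' g) -/x0 x00 linear_fun0.
have [f [ff fx fmax]] := isotropic_pivot isoflagP x0_neq0 x0x0.
set c := co x0 f in fx; have fX := x0X _ fx.
have [||T [Tf Tif Tout PT]] :=
  @eichler_exists _ _ _ _ basis_b _ _ _ iso _ _ eps2 epsE ff (c^-1 *: x0).
- by rewrite coZ mulVf.
- rewrite (scalar_funZ _ _ (form_scalarr iso _)).
  by rewrite (scalar_funZ _ _ (form_scalarl iso _)) x0x0 !mulr0.
have {}PT : flag_stabilizer b G sigmaP T.
  by apply: PT => // e; rewrite coZ mulf_eq0 negb_or => /andP[_ /fmax].
have iX e : e \notin X -> iE e \notin X by apply: contra => /Xi; rewrite iK.
have {}Tout e : e \notin X -> T (b e) = b e.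
  move=> eX; apply: Tout; first by apply: contraNneq eX => ->.
  by apply: contraNeq (iX _ eX); rewrite coZ mulf_eq0 negb_or => /andP[_ /x0X].
have mo1 : monomial_outside basis_b G X w (g * T)%g.
  apply: mo_isom => //; first by apply: ind_setM => //; case: PT.
  by move=> e eX; rewrite sym_mulE Tout //; exact: (mo_out mo eX).
have g1f : (g * T)%g (b f) = c^-1 *: b e1.
  by rewrite sym_mulE Tf linear_funZ // /x0 sym_invE'.
have [_ _ g1G] := mo_ind mo1.
(* The image of [b f] is now a multiple of [b e1], so [y] pairs nontrivially with [b e1] and its
   coordinate at [iE e1] cannot vanish. *)
set y := (g * T)%g (b (iE f)).
have yX e : co y e != 0 -> w^-1%g e \in X by apply: (mo_in mo1); apply: Xi.
have y_ie1 : co y (iE e1) != 0.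
  have := g1G (b f) (b (iE f)) I I.
  rewrite g1f -/y (scalar_funZ _ _ (form_scalarl iso _)) (form_basisr basis_b iso).
  move=> yE; have := form_basis_neq0 basis_b iso f; rewrite -yE.
  by apply: contraNneq => ->; rewrite mul0r mulr0.
set cy := co y (iE e1) in y_ie1.
have yy : omega y y = 0.
  by rewrite /y g1G // om_e1 // iK eq_sym.
have ie10 : iE (iE e1) != iE e1 by rewrite iK eq_sym.
(* Dually to the choice of [e1], its partner [iE e1] is largest among the remaining targets, which
   contain the support of [y]. The inverse of [T2] straightens [y] while keeping [b e1]. *)
have [||T2 [T2f T2if T2out BT]] :=
  @eichler_exists _ _ _ _ basis_b _ _ _ iso _ _ eps2 epsE ie10 (cy^-1 *: y).
- by rewrite coZ mulVf.
- rewrite (scalar_funZ _ _ (form_scalarr iso _)).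
  by rewrite (scalar_funZ _ _ (form_scalarl iso _)) yy !mulr0.
have {}BT : flag_stabilizer b G sigmaB T2.
  apply: BT => // e; rewrite coZ mulf_eq0 negb_or => /andP[_ /yX /Xi /f'min].
  rewrite wi (sym_invE' w) => /(isotropic_flag_le basis_b iso isoflagB).
  by rewrite iK.
rewrite iK in T2if.
have {}T2out e : e \notin X -> T2 (b (w e)) = b (w e).
  move=> eX; apply: T2out.
    rewrite /e1 -wi (can_eq (sym_funK w)).
    by apply: contraNneq eX => ->; apply: Xi.
  apply: contraNeq (iX _ eX); rewrite coZ mulf_eq0 negb_or => /andP[_ /yX].
  by rewrite -wi /= (sym_funK w).
have T2l : linear T2 by case: BT => [[]].
have T2Vl := linear_sym_inv T2l.
have ff' : iE f = f <-> iE f' = f'.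
  by split=> /eqP; rewrite ?(negPf ff) ?(negPf f'0).
pose s := dual_swap iK ff'.
exists T2^-1%g, T, (X `\ f `\ iE f)%fset, (w * s)%g; split=> //.
  rewrite [X in (_ < X)%N](cardfsD1 f) fX ltnS; apply: fsubset_leq_card.
  exact: fsubsetDl.
apply: mo_isom.
- apply: ind_setM; last by case: PT.
  by apply: ind_setM => //; apply: ind_setV; case: BT.
- by apply: weyl_dual_swap => //; split=> //; apply/eqP.
- move=> e; rewrite !in_fsetD1 => /and3P[eif ef eX].
  by rewrite (can_eq iK) ef Xi // andbT -(can_eq iK) iK.
move=> e; rewrite !in_fsetD1 !negb_and !negbK => /or3P[/eqP->|/eqP->|eX].
- exists cy => //; rewrite -mulgA [LHS]sym_mulE -/y.
  have -> : y = T2 (cy *: b (iE e1)).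
    by rewrite linear_funZ // T2f scalerA mulfV // scale1r.
  rewrite sym_invE sym_mulE /s dual_swap_comm; last exact/eqP.
  by rewrite dual_swapl wi.
- exists c^-1; first by rewrite invr_eq0.
  rewrite -mulgA [LHS]sym_mulE g1f -{1}T2if -linear_funZ // sym_invE.
  by rewrite sym_mulE /s dual_swapl.
have [a a0 ge] := mo_out mo eX; exists a => //.
have ef : e != f by apply: contraNneq eX => ->.
have ef' : e != f' by apply: contraNneq eX => ->.
have eif : e != iE f by apply: contraNneq eX => ->; apply: Xi.
have eif' : e != iE f' by apply: contraNneq eX => ->; apply: Xi.
rewrite -mulgA [LHS]sym_mulE [(g * T)%g _]sym_mulE Tout // ge.
rewrite -{1}T2out // -linear_funZ // sym_invE.
by rewrite sym_mulE /s dual_swap_out.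
Qed.

End IsometryElimination.

(** * The decomposition *)

Section Decomposition.
Variables (K : closedFieldType) (V : lmodType K) (E : countType) (b : E -> V).
Hypothesis charK : [pchar K]%R =i pred0.
Hypothesis basis_b : is_basis b.
Variables (F : nat -> {fset E}) (G : ind_group V E).
Hypothesis filtF : is_filtration F.
Hypothesis admG : admissible b F G.
Variables (dP dB : Order.disp_t) (AP : orderType dP) (AB : orderType dB).
Variables (sigmaP : E -> AP) (sigmaB : E -> AB).
Variables (B P : set (sym V)).
Hypotheses (flagP : is_flag_of b G sigmaP P) (flagB : is_flag_of b G sigmaB B).

Lemma borel_flag_inj : splitting_borel b F G B -> injective sigmaB.
Proof.
case=> -[clB _ solvB] _; case: flagB => _; move: admG clB solvB.
case: G => [_ clB solvB _ BE|omega iE iso clB solvB isoB BE].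
  exact: (borel_flag_inj_gen charK basis_b filtF clB solvB BE).
exact: (borel_flag_inj_isom charK basis_b filtF iso isoB clB solvB BE).
Qed.

Lemma elimination X (w : sym E) g : subgroup B -> subgroup P -> injective sigmaB ->
  monomial_outside basis_b G X w g ->
  exists beta p w', [/\ B beta, P p, weyl G w' & monomial b w' (beta * g * p)%g].
Proof.
move=> [B1 BM BV] [P1 PM PV] sigmaB_inj.
have [[_ isoP PE] [_ isoB BE]] := (flagP, flagB).
move: {2}(#|` X|).+1 (ltnSn #|` X|) => n.
elim: n X w g => // n IHn X w g Xn mo.
have step : (exists beta p X' w', [/\ B beta, P p, (#|` X'| < #|` X|)%N &
      monomial_outside basis_b G X' w' (beta * g * p)%g]) \/
    (forall e, e \in X -> if G is Isom _ iE then iE e = e else False).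
  have [[e [eX ne]]|nex] := pselect (exists e, e \in X /\
      (if G is Isom _ iE then iE e != e else True)); last first.
    right=> e eX; apply: contrapT => ne; apply: nex; exists e; split=> //.
    by case: G ne => // _ iE /eqP.
  left; move: isoP isoB PE BE admG mo ne; case: G => [_ _ PE BE _ mo _|
      omega iE isoP isoB PE BE iso mo ne].
    have X0 : X != fset0 by apply/fset0Pn; exists e.
    have [beta [p [X' [w' [Bbeta Pp X'X mo']]]]] :=
      elimination_step_gen sigmaP sigmaB X0 mo.
    by exists beta, p, X', w'; rewrite BE PE.
  have [beta [p [X' [w' [Bbeta Pp X'X mo']]]]] :=
    elimination_step_isom iso isoP isoB sigmaB_inj eX ne mo.
  exists beta, p, X', w'; split=> //; last by rewrite PE.
  by rewrite -[beta]invgK; apply: BV; rewrite BE.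
case: step => [[beta [p [X' [w' [Bbeta Pp X'X mo']]]]]|fixX].
  have [beta' [p' [w'' [Bbeta' Pp' Gw'' mon]]]] :=
    IHn X' w' _ (leq_trans X'X Xn) mo'.
  exists (beta' * beta)%g, (p * p')%g, w''; split=> //; [exact: BM | exact: PM].
exists 1%g, 1%g, w; split=> //; first exact: mo_weyl mo.
by rewrite mul1g mulg1; apply: (mo_terminal admG mo fixX).
Qed.

Lemma relative_position_le (beta p nw nw' : sym V) (w w' : sym E) :
  injective sigmaB -> B beta -> P p -> linear nw -> linear nw' ->
  monomial b w nw -> monomial b w' nw' -> (beta * nw')%g = (nw * p)%g ->
  forall e, (sigmaP (w^-1%g e) <= sigmaP (w'^-1%g e))%O.
Proof.
move=> sigmaB_inj Bbeta Pp nwl nwl' wm wm' eq e.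
have [[_ _ PE] [_ _ BE]] := (flagP, flagB).
rewrite PE in Pp; rewrite BE in Bbeta.
have Gp : ind_set b G p by case: Pp.
have [p_tri _] := (flag_stabilizerP basis_b sigmaP Gp).1 Pp.
have := triangular_diag_neq0 basis_b e sigmaB_inj Bbeta.
have [c c0 we] := monomialV nwl' wm' e.
have -> : beta = (nw * p * nw'^-1)%g by rewrite -eq mulgK.
rewrite 2!sym_mulE we -{2}(sym_invE' w e) => /(monomial_co nwl wm).
rewrite (linear_funZ _ _ (ind_set_linear Gp)) coZ mulf_eq0 negb_or => /andP[_].
exact: p_tri.
Qed.

End Decomposition.

Theorem corollary1
  (K : closedFieldType) (charK : [pchar K]%R =i pred0)
  (V : lmodType K) (E : countType) (infE : infinite_set [set: E])
  (b : E -> V) (basis_b : is_basis b)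
  (F : nat -> {fset E}) (filtF : is_filtration F)
  (G : ind_group V E) (admG : admissible b F G)
  (P B : set (sym V))
  (paraP : splitting_parabolic b F G P) (borelB : splitting_borel b F G B)
  (dP : Order.disp_t) (AP : orderType dP) (sigmaP : E -> AP)
  (flagP : is_flag_of b G sigmaP P)
  (dB : Order.disp_t) (AB : orderType dB) (sigmaB : E -> AB)
  (flagB : is_flag_of b G sigmaB B)
  (hat : sym E -> sym V)
  (hatP : forall w, weyl G w -> representative b G w (hat w)) :
  [/\ ind_set b G = \bigcup_(w in weyl G) double_coset B (hat w) P,
      forall w w', weyl G w -> weyl G w' ->
        weyl_of_flag G sigmaP (w^-1 * w')%g ->
        double_coset B (hat w) P = double_coset B (hat w') P
    & forall w w', weyl G w -> weyl G w' ->
        ~ weyl_of_flag G sigmaP (w^-1 * w')%g ->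
        double_coset B (hat w) P `&` double_coset B (hat w') P = set0].
Proof.
have sigmaB_inj := borel_flag_inj charK basis_b filtF admG flagB borelB.
have [[sP PG _] _] := paraP; have [[[sB BG _] _ _] _] := borelB.
have [[P1 PM PV] [B1 BM BV]] := (sP, sB); have [_ _ PE] := flagP.
have hatG w : weyl G w -> ind_set b G (hat w) by move=> /hatP[].
have hatl w : weyl G w -> linear (hat w) by move=> /hatG/ind_set_linear.
have hatm w : weyl G w -> monomial b w (hat w).
  by move=> /hatP; apply: representative_monomial.
split.
- apply/seteqP; split=> [g Gg|g [w Gw [y By [z Pz <-]]]]; last first.
    by apply: ind_setM; [apply: ind_setM; [apply: BG | apply: hatG] | apply: PG].
  have [X mo] := ind_set_monomial_outside basis_b filtF admG Gg.
  have [beta [p [w [Bbeta Pp Gw mon]]]] :=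
    elimination admG flagP flagB sB sP sigmaB_inj mo.
  exists w => //; exists (beta^-1)%g; first exact: BV.
  (* Both [hat w] and [beta * g * p] are monomial for [w], so their quotient is diagonal and lies in
     [P]. *)
  exists ((hat w)^-1 * (beta * g * p) * p^-1)%g; last first.
    by rewrite !mulgA !mulgK mulVg mul1g.
  apply: PM; last exact: PV.
  rewrite PE; apply: (@monomial_stabilizer _ _ _ _ basis_b _ _ _ _ 1%g).
  + apply: ind_setM; first by apply: ind_setV; apply: hatG.
    by apply: ind_setM; [apply: ind_setM => //; apply: BG | apply: PG].
  + have := monomialM (linear_sym_inv (hatl w Gw)) (monomialV (hatl w Gw) (hatm w Gw)) mon.
    move=> H e; have [c c0 ce] := H e; exists c => //.
    by rewrite [LHS]ce /= (sym_funK w).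
  by apply: funext.
- move=> w w' Gw Gw' [_ sw].
  have Pp : P ((hat w)^-1 * hat w')%g.
    rewrite PE; apply: (monomial_stabilizer basis_b _ _ sw).
      by apply: ind_setM; [apply: ind_setV; apply: hatG | apply: hatG].
    exact: (monomialM (linear_sym_inv (hatl w Gw))
      (monomialV (hatl w Gw) (hatm w Gw)) (hatm w' Gw')).
  apply/seteqP; split=> g [y By [z Pz <-]]; exists y => //.
    exists (((hat w)^-1 * hat w')^-1 * z)%g; first by apply: PM => //; apply: PV.
    by rewrite invgM invgK !mulgA mulgK.
  exists ((hat w)^-1 * hat w' * z)%g; first exact: PM.
  by rewrite !mulgA mulgK.
move=> w w' Gw Gw' nW; apply/seteqP; split=> // g [[y By [z Pz zE]] [y' By' [z' Pz' zE']]].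
apply: nW; split.
  have [[wf wG] [wf' wG']] := (Gw, Gw'); split.
    apply: (@sub_finite_set _ _ ([set e | w e <> e] `|` [set e | w' e <> e])).
      move=> e ne; apply: contrapT => /not_orP[/contrapT we /contrapT we'].
      by apply: ne; rewrite sym_mulE we' -{1}we sym_invE.
    by rewrite finite_setU.
  case: (G) wG wG' => // _ iE wG wG' e.
  by apply: (can_inj (sym_invE' w^-1%g)); rewrite invgK wG !sym_mulE !sym_invE' wG'.
have eq1 : (y^-1 * y' * hat w')%g = (hat w * (z * z'^-1))%g.
  by apply: (mulgI y); apply: (mulIg z'); rewrite !mulgA mulgVK mulgV mul1g zE zE'.
have eq2 : (y'^-1 * y * hat w)%g = (hat w' * (z' * z^-1))%g.
  by apply: (mulgI y'); apply: (mulIg z); rewrite !mulgA mulgVK mulgV mul1g zE zE'.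
have le1 := relative_position_le basis_b flagP flagB sigmaB_inj
  (BM _ _ (BV _ By) By') (PM _ _ Pz (PV _ Pz')) (hatl w Gw) (hatl w' Gw')
  (hatm w Gw) (hatm w' Gw') eq1.
have le2 := relative_position_le basis_b flagP flagB sigmaB_inj
  (BM _ _ (BV _ By') By) (PM _ _ Pz' (PV _ Pz)) (hatl w' Gw') (hatl w Gw)
  (hatm w' Gw') (hatm w Gw) eq2.
apply: funext => e; apply/eqP; rewrite /= -/(w'^-1%g _).
have := le1 (w e); have := le2 (w e); rewrite (sym_invE w) => ? ?.
by rewrite eq_le; apply/andP; split.
Qed.
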